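(* Let $[a:b:c]\in\mathbb{P}^2$ be such that ${}_3E_{a,b,c}=\mathbf{V}\big(abc(X^3+Y^3+Z^3)-(a^3+b^3+c^3)XYZ\big)\subset\mathbb{P}^2$ is a smooth curve of genus 1, let ${}_3S_{a,b,c}$ be the corresponding quadratic Sklyanin algebra and ${}_3c_{a,b,c}$ its normal element of degree 3 generating $\bigcap_{p\in{}_3E_{a,b,c}}\mathrm{Ann}(M_p)$. Then the vector space $\mathbb{C}\,{}_3c_{a,b,c}$ is isomorphic to the trivial representation of $H_3$. In addition, taking the basis $$f_1=zxy+xyz+yzx,\qquad f_2=yxz+zyx+xzy,\qquad f_3=x^3+y^3+z^3$$ of $({}_3V_1^{\otimes3})^{H_3}$, the element ${}_3c_{a,b,c}$ is (up to a nonzero scalar) the image in ${}_3S_{a,b,c}$ of $\alpha f_1+\beta f_2+\gamma f_3$ with $[\alpha:\beta:\gamma]=-2\tau$ for the addition law on ${}_3E_{a,b,c}$, where $\tau=[a:b:c]$ and the origin is $O=[1:-1:0]$.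
   Context: All algebras are over $\mathbb{C}$. The quadratic Sklyanin algebra ${}_3S_{a,b,c}$ is the quotient of $\mathbb{C}\langle x,y,z\rangle$ (generators in degree 1) by the relations $ayz+bzy+cx^2$, $azx+bxz+cy^2$, $axy+byx+cz^2$, under the condition that ${}_3E_{a,b,c}$ is a smooth curve of genus 1. The curve ${}_3E_{a,b,c}$ is an elliptic curve with origin $O=[1:-1:0]$, and $\tau=[a:b:c]\in{}_3E_{a,b,c}$. $H_3=\langle e_1,e_2:e_1^3=e_2^3=[e_1,e_2]^3=1,\ [e_1,e_2]\text{ central}\rangle$. ${}_3V_1=\mathbb{C}x+\mathbb{C}y+\mathbb{C}z$ is the $H_3$-representation $e_1\cdot x=z$, $e_1\cdot y=x$, $e_1\cdot z=y$, $e_2\cdot x=x$, $e_2\cdot y=\omega y$, $e_2\cdot z=\omega^2z$, with $\omega$ a primitive third root of unity. $H_3$ acts on $T({}_3V_1)=\mathbb{C}\langle x,y,z\rangle$ and this induces an action on ${}_3S_{a,b,c}$ by graded automorphisms. A point module is a cyclic graded right module with Hilbert series $(1-t)^{-1}$. The point modules of ${}_3S_{a,b,c}$ are, up to isomorphism, exactly the modules $M_p=\bigoplus_{i\ge0}\mathbb{C}m_i$, $p\in{}_3E_{a,b,c}$, with $m_ix=x_im_{i+1}$, $m_iy=y_im_{i+1}$, $m_iz=z_im_{i+1}$, $[x_i:y_i:z_i]=p+i\tau$. By a result of Artin, Tate and Van den Bergh, the ideal $\bigcap_{p}\mathrm{Ann}(M_p)$ is generated by a (nonzero) normal element of degree 3,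 unique up to scalar, denoted ${}_3c_{a,b,c}$. *)

(* Defs.v *)
From HB Require Import structures.
From mathcomp Require Import all_boot all_order all_algebra all_fingroup.
From mathcomp Require Import all_character.
From mathcomp Require Import finmap boolp reals complex mpoly.

Set Implicit Arguments.
Unset Strict Implicit.
Unset Printing Implicit Defensive.

Import GRing.Theory.

Local Open Scope ring_scope.
Local Open Scope quotient_scope.

Section TwoSidedIdeals.
Variable A : pzRingType.

Definition two_sided_ideal (I : A -> Prop) : Prop :=
  [/\ I 0, forall u v, I u -> I v -> I (u - v)
         & forall u v w, I v -> I (u * v * w)].

Definition ideal_gen (X : A -> Prop) (u : A) : Prop :=
  forall I, two_sided_ideal I -> (forall v, X v -> I v) -> I u.

Lemma ideal_genP X : two_sided_ideal (ideal_gen X).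
Proof.
split=> [I [] //|u v Iu Iv I idI XI|u v w Iv I idI XI].
  by case: (idI) => _ IB _; apply: IB; [apply: Iu | apply: Iv].
by case: (idI) => _ _ IM; apply: IM; apply: Iv.
Qed.

(* [c A = A c] *)
Definition normal_elt (c : A) : Prop :=
  (forall s, exists s', c * s = s' * c) /\ (forall s, exists s', s * c = c * s').

End TwoSidedIdeals.

Section PlaneCubics.
Variable K : fieldType.

(* Points of P^2(K) are given by nonzero row vectors of homogeneous
   coordinates; [vec3 a b c] represents [a : b : c]. *)
Definition vec3 (a b c : K) : 'rV[K]_3 := \row_i [:: a; b; c]`_i.

Definition hesse_cubic (a b c : K) : {mpoly K[3]} :=
  (a * b * c) *: ('X_0 ^+ 3 + 'X_1 ^+ 3 + 'X_2 ^+ 3)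
  - (a ^+ 3 + b ^+ 3 + c ^+ 3) *: ('X_0 * 'X_1 * 'X_2).

Variable F : {mpoly K[3]}.

Definition evalv (G : {mpoly K[3]}) (v : 'rV[K]_3) : K := G.@[v 0].

Definition on_curve (v : 'rV[K]_3) : Prop := v != 0 /\ evalv F v = 0.

(* Jacobian criterion.  When [F] is a cubic form this says that V(F) is a
   smooth plane cubic, whose genus is (3 - 1)(3 - 2)/2 = 1; it excludes F = 0. *)
Definition smooth_curve : Prop :=
  forall v, on_curve v -> exists i, evalv (F^`M(i)) v != 0.

(* Some line of P^2 cuts the divisor (P) + (Q) + (S) on the cubic V(F).  The
   line is the span of the rows of [B], parametrised by t |-> t *m B, and
   \det (col_mx t p) = t_0 p_1 - t_1 p_0 is the linear form on it vanishing
   exactly at the point of parameter p, so multiplicities are accounted for. *)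
Definition line_section (P Q S : 'rV[K]_3) : Prop :=
  [/\ on_curve P, on_curve Q, on_curve S &
  exists (B : 'M[K]_(2, 3)) (p q s : 'rV[K]_2) (k : K),
    [/\ row_free B, k != 0,
        [/\ P = p *m B, Q = q *m B & S = s *m B] &
        forall t : 'rV[K]_2, evalv F (t *m B) =
          k * (\det (col_mx t p : 'M_2) * \det (col_mx t q : 'M_2)
               * \det (col_mx t s : 'M_2))]].

(* The chord-tangent law with origin [O]: [P + Q = S] when [S] is the third
   point of V(F) on the line through [O] and the third point of V(F) on the
   line through [P] and [Q]. *)
Definition add_pt (O P Q S : 'rV[K]_3) : Prop :=
  exists N, line_section P Q N /\ line_section O N S.

(* [W = - 2 P] *)
Definition opp2_pt (O P W : 'rV[K]_3) : Prop :=
  exists D, add_pt O P P D /\ add_pt O D W O.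

End PlaneCubics.

(* Only now, as monalg and mpoly reuse each other's names. *)
From mathcomp Require Import monalg.

Section H3.
Local Open Scope group_scope.

(* [H] is the group presented by the generators [e1], [e2] and these relations:
   the isomorphism alone would not fix the generators. *)
Definition is_H3 (gT : finGroupType) (H : {group gT}) (e1 e2 : gT) : Prop :=
  [/\ H :=: <<[set e1; e2]>>,
      [/\ e1 ^+ 3 = 1, e2 ^+ 3 = 1 & [~ e1, e2] ^+ 3 = 1],
      [~ e1, e2] \in 'C(H) &
      H \isog Grp (u : v : u ^+ 3, v ^+ 3, [~ u, v] ^+ 3,
                           [~ u, v, u], [~ u, v, v])].

End H3.

(* C<x, y, z>, as the algebra over C = R[i] of the free monoid on 3 letters *)
Notation free_alg R := {malg R[i][{fmonom 'I_3}]}.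

Section Sklyanin.
Variable R : realType.
Local Notation C := R[i].
Local Notation free3 := (free_alg R).

Definition gen3 (i : 'I_3) : free3 := << fmu i >>.

Local Notation x := (gen3 0).
Local Notation y := (gen3 1).
Local Notation z := (gen3 2).

(* the component of degree [n], i.e. the tensor power V_1^{(x) n} *)
Definition homog3 (n : nat) (f : free3) : Prop :=
  forall w : {fmonom 'I_3}, mcoeff w f != 0 -> fdeg w = n.

(* The algebra endomorphism x_j |-> \sum_i A_ij x_i.  With this convention
   [A |-> lin_subst A] turns products of matrices into compositions. *)
Definition lin_subst (A : 'M[C]_3) (f : free3) : free3 :=
  mmap (in_alg free3)
       (fun w : {fmonom 'I_3} =>
          \prod_(j <- (w : seq 'I_3)) \sum_i A i j *: gen3 i) f.

Section Algebra.
Variables a b c : C.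

Definition skl_curve := hesse_cubic a b c.
Definition skl_O : 'rV[C]_3 := vec3 1 (-1) 0.
Definition skl_tau : 'rV[C]_3 := vec3 a b c.

Definition skl_rel (f : free3) : Prop :=
  [\/ f = a *: (y * z) + b *: (z * y) + c *: x ^+ 2,
      f = a *: (z * x) + b *: (x * z) + c *: y ^+ 2
    | f = a *: (x * y) + b *: (y * x) + c *: z ^+ 2].

Definition skl_ideal (f : free3) : bool := `[< ideal_gen skl_rel f >].

Lemma skl_idealP f : reflect (ideal_gen skl_rel f) (f \in skl_ideal).
Proof. exact: (iffP (asboolP _)). Qed.

Lemma skl_ideal_zmod : zmod_closed skl_ideal.
Proof.
have [I0 IB _] := ideal_genP skl_rel; split=> [|u v].
  by apply/skl_idealP; apply: I0.
by move=> /skl_idealP Iu /skl_idealP Iv; apply/skl_idealP; apply: IB.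
Qed.

HB.instance Definition _ := GRing.isZmodClosed.Build free3 skl_ideal
  skl_ideal_zmod.

Lemma skl_idealM u v w : v \in skl_ideal -> u * v * w \in skl_ideal.
Proof.
have [_ _ IM] := ideal_genP skl_rel.
by move=> /skl_idealP Iv; apply/skl_idealP; apply: IM.
Qed.

Lemma skl_ideal1 : 1 \notin skl_ideal.
Proof.
pose e : {rmorphism free3 -> C} := mcoeff (mone : {fmonom 'I_3}).
have e0 i : e (gen3 i) = 0 by rewrite /= mcoeffU1 fm1_eq1.
have e2 k i j : e (k *: (gen3 i * gen3 j)) = 0.
  by rewrite [LHS]mcoeffZ (rmorphM e) e0 mul0r mulr0.
have eD f g : e f = 0 -> e g = 0 -> e (f + g) = 0.
  by move=> ef eg; rewrite rmorphD ef eg addr0.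
have e3 i j k : e (a *: (gen3 i * gen3 j) + b *: (gen3 j * gen3 i)
                   + c *: gen3 k ^+ 2) = 0.
  exact: (eD _ _ (eD _ _ (e2 _ _ _) (e2 _ _ _)) (e2 c k k)).
apply/negP=> /skl_idealP /(_ (fun f => e f = 0)) H.
suff /eqP : e 1 = 0 by rewrite rmorph1 oner_eq0.
apply: H => [|v].
  split=> [|u v eu ev|u v w ev]; first exact: rmorph0.
    by rewrite rmorphB eu ev subr0.
  by rewrite !rmorphM ev mulr0 mul0r.
by case=> ->; apply: e3.
Qed.

Definition skl_zmodClosed := GRing.ZmodClosed.clone _ skl_ideal _.

Definition sklyanin : Type := {ideal_quot skl_zmodClosed}.
HB.instance Definition _ := GRing.Zmodule.on sklyanin.

Definition skl_pi (f : free3) : sklyanin := \pi_({ideal_quot skl_zmodClosed}) f.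
Definition skl_repr (s : sklyanin) : free3 :=
  generic_quotient.repr (s : {ideal_quot skl_zmodClosed}).

Lemma skl_reprK s : skl_pi (skl_repr s) = s.
Proof. exact: reprK. Qed.

Lemma skl_piE f g : skl_pi f = skl_pi g <-> f - g \in skl_ideal.
Proof. by rewrite Quotient.idealrBE; split=> /eqP. Qed.

Lemma skl_piW s : exists f, s = skl_pi f.
Proof. by exists (skl_repr s); rewrite skl_reprK. Qed.

Lemma skl_piD f g : skl_pi (f + g) = skl_pi f + skl_pi g.
Proof. exact: raddfD. Qed.

Lemma skl_repr_pi f : skl_repr (skl_pi f) - f \in skl_ideal.
Proof. by apply/skl_piE; rewrite skl_reprK. Qed.

Definition skl_one : sklyanin := skl_pi 1.
Definition skl_mul (s t : sklyanin) := skl_pi (skl_repr s * skl_repr t).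
Definition skl_scale (k : C) (s : sklyanin) := skl_pi (k *: skl_repr s).

Lemma skl_mulE f g : skl_mul (skl_pi f) (skl_pi g) = skl_pi (f * g).
Proof.
apply/skl_piE; set f' := skl_repr _; set g' := skl_repr _.
have -> : f' * g' - f * g = 1 * (f' - f) * g' + f * (g' - g) * 1.
  by rewrite mul1r mulr1 mulrBl mulrBr addrA addrNK.
by rewrite rpredD // skl_idealM // skl_repr_pi.
Qed.

Lemma skl_scaleE k f : skl_scale k (skl_pi f) = skl_pi (k *: f).
Proof.
apply/skl_piE; set f' := skl_repr _.
have -> : k *: f' - k *: f = k%:A * (f' - f) * 1.
  by rewrite mulr1 -scalerAl mul1r scalerBr.
by rewrite skl_idealM // skl_repr_pi.
Qed.

Lemma skl_mulA : associative skl_mul.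
Proof.
move=> s t u; have [f ->] := skl_piW s; have [g ->] := skl_piW t.
by have [h ->] := skl_piW u; rewrite !skl_mulE mulrA.
Qed.

Lemma skl_mul1s : left_id skl_one skl_mul.
Proof. by move=> s; have [f ->] := skl_piW s; rewrite skl_mulE mul1r. Qed.

Lemma skl_muls1 : right_id skl_one skl_mul.
Proof. by move=> s; have [f ->] := skl_piW s; rewrite skl_mulE mulr1. Qed.

Lemma skl_mulDl : left_distributive skl_mul +%R.
Proof.
move=> s t u; have [f ->] := skl_piW s; have [g ->] := skl_piW t.
by have [h ->] := skl_piW u; rewrite -skl_piD !skl_mulE mulrDl skl_piD.
Qed.

Lemma skl_mulDr : right_distributive skl_mul +%R.
Proof.
move=> s t u; have [f ->] := skl_piW s; have [g ->] := skl_piW t.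
by have [h ->] := skl_piW u; rewrite -skl_piD !skl_mulE mulrDr skl_piD.
Qed.

Lemma skl_one_neq0 : skl_one != 0.
Proof.
have <- : skl_pi 0 = 0 by exact: raddf0.
apply/eqP => /skl_piE; rewrite subr0.
exact/negP/skl_ideal1.
Qed.

HB.instance Definition _ := GRing.Zmodule_isNzRing.Build sklyanin
  skl_mulA skl_mul1s skl_muls1 skl_mulDl skl_mulDr skl_one_neq0.

Lemma skl_scaleA k l s : skl_scale k (skl_scale l s) = skl_scale (k * l) s.
Proof. by have [f ->] := skl_piW s; rewrite !skl_scaleE scalerA. Qed.

Lemma skl_scale1 : left_id 1 skl_scale.
Proof. by move=> s; have [f ->] := skl_piW s; rewrite skl_scaleE scale1r. Qed.

Lemma skl_scaleDr : right_distributive skl_scale +%R.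
Proof.
move=> k s t; have [f ->] := skl_piW s; have [g ->] := skl_piW t.
by rewrite -skl_piD !skl_scaleE scalerDr skl_piD.
Qed.

Lemma skl_scaleDl s : {morph skl_scale^~ s : k l / k + l}.
Proof.
by move=> k l; have [f ->] := skl_piW s; rewrite !skl_scaleE scalerDl skl_piD.
Qed.

HB.instance Definition _ := GRing.Zmodule_isLmodule.Build C sklyanin
  skl_scaleA skl_scale1 skl_scaleDr skl_scaleDl.

Lemma skl_scaleAl k (s t : sklyanin) : k *: (s * t) = k *: s * t.
Proof.
have [f ->] := skl_piW s; have [g ->] := skl_piW t.
by rewrite -[LHS]/(skl_scale _ (skl_mul _ _))
  -[RHS]/(skl_mul (skl_scale _ _) _) !(skl_mulE, skl_scaleE) scalerAl.
Qed.

HB.instance Definition _ := GRing.Lmodule_isLalgebra.Build C sklyanin skl_scaleAl.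

Lemma skl_pi_zmod : zmod_morphism skl_pi. Proof. exact: raddfB. Qed.

Lemma skl_pi_monoid : monoid_morphism skl_pi.
Proof. by split=> [|f g]; [exact: erefl | exact: esym (skl_mulE f g)]. Qed.

Lemma skl_pi_scalable : scalable skl_pi.
Proof. by move=> k f; exact: esym (skl_scaleE k f). Qed.

HB.instance Definition _ := GRing.isZmodMorphism.Build free3 sklyanin skl_pi
  skl_pi_zmod.
HB.instance Definition _ := GRing.isMonoidMorphism.Build free3 sklyanin skl_pi
  skl_pi_monoid.
HB.instance Definition _ := GRing.isScalable.Build C free3 sklyanin *:%R skl_pi
  skl_pi_scalable.

Definition skl_homog (n : nat) (s : sklyanin) : Prop :=
  exists2 f, homog3 n f & s = skl_pi f.

(* The endomorphism of the quotient induced by [lin_subst A]; it does not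
   depend on representatives when [lin_subst A] preserves the relations, which
   is the case for the action of the Heisenberg group: see [skl_actE]. *)
Definition skl_act (A : 'M[C]_3) (s : sklyanin) : sklyanin :=
  skl_pi (lin_subst A (skl_repr s)).

Lemma skl_actE A f :
    (forall g, g \in skl_ideal -> lin_subst A g \in skl_ideal) ->
  skl_act A (skl_pi f) = skl_pi (lin_subst A f).
Proof.
by move=> AI; apply/skl_piE; rewrite -raddfB AI // skl_repr_pi.
Qed.

(* Right modules over the Sklyanin algebra are left modules over its converse
   ring; C acts through the constants. *)
Section RightModules.
Variable M : lmodType sklyanin^c.

Definition ract (v : M) (s : sklyanin) : M := (s : sklyanin^c) *: v.
Definition cscale (k : C) (v : M) : M := ract v k%:A.

(* [M] is the point module M_p: (m_i) is a C-basis (finite families of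
   coefficients are encoded as polynomials), the coordinates of p + i tau are
   pt_i, and m_i x_j = (pt_i)_j m_(i+1). *)
Definition is_point_module (p : 'rV[C]_3) : Prop :=
  exists (m : nat -> M) (pt : nat -> 'rV[C]_3),
    [/\ forall v, exists! q : {poly C}, v = \sum_(i < size q) cscale q`_i (m i),
        pt 0%N = p,
        forall i, add_pt skl_curve skl_O (pt i) skl_tau (pt i.+1) &
        forall i j, ract (m i) (skl_pi (gen3 j)) = cscale (pt i 0 j) (m i.+1)].

Definition annihilates (s : sklyanin) : Prop := forall v, ract v s = 0.

End RightModules.

(* [s] lies in the intersection of the annihilators of all the M_p *)
Definition annihilates_points (s : sklyanin) : Prop :=
  forall p, on_curve skl_curve p ->
  forall M : lmodType sklyanin^c, is_point_module M p -> annihilates M s.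

(* [s] is a normal element of degree 3 generating the intersection of the
   annihilators of the M_p; these properties determine it up to a scalar. *)
Definition is_c3 (s : sklyanin) : Prop :=
  [/\ s != 0, skl_homog 3 s, normal_elt s &
      forall t, ideal_gen (eq s) t <-> annihilates_points t].

End Algebra.

Definition f1 : free3 := z * x * y + x * y * z + y * z * x.
Definition f2 : free3 := y * x * z + z * y * x + x * z * y.
Definition f3 : free3 := x ^+ 3 + y ^+ 3 + z ^+ 3.

Section Representations.
Variables (gT : finGroupType) (H : {group gT}).

(* [rV] is the representation V_1.  Elements of [H] act on the left: the image
   of x_j under g is given by the column j of the matrix [rV g]. *)
Definition is_V1 (rV : mx_representation C H 3) (e1 e2 : gT) (w : C) : Prop :=
  [/\ lin_subst (rV e1) x = z, lin_subst (rV e1) y = x &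
      lin_subst (rV e1) z = y] /\
  [/\ lin_subst (rV e2) x = x, lin_subst (rV e2) y = w *: y &
      lin_subst (rV e2) z = w ^+ 2 *: z].

Variable rV : mx_representation C H 3.

Definition h3_invariant (n : nat) (f : free3) : Prop :=
  homog3 n f /\ forall g, g \in H -> lin_subst (rV g) f = f.

(* The line C s is isomorphic to the trivial representation, which is C with
   every element of [H] acting as the identity. *)
Definition trivial_line (a b c : C) (s : sklyanin a b c) : Prop :=
  exists phi : {linear C^o -> sklyanin a b c},
    [/\ injective phi,
        forall t, (exists k, phi k = t) <-> (exists k : C, t = k *: s) &
        forall g k, g \in H -> skl_act (rV g) (phi k) = phi k].

End Representations.
End Sklyanin.

(* Main.v *)
Require Import Defs.
From HB Require Import structures.
From mathcomp Require Import all_boot all_order all_algebra all_fingroup.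
From mathcomp Require Import all_character.
From mathcomp Require Import mpoly.
From mathcomp Require Import reals complex monalg.
From mathcomp Require Import ring.

Set Implicit Arguments.
Unset Strict Implicit.
Unset Printing Implicit Defensive.

Import GRing.Theory.
Local Open Scope ring_scope.

(* The third point on the tangent to the Hesse cubic at tau = [a : b : c] is
   N = [a(b^3 - c^3) : b(c^3 - a^3) : c(a^3 - b^3)]; since O is a flex, N = -2 tau.
   Let g be the combination of f1, f2, f3 with the coordinates of N as
   coefficients.  If p, q, r are consecutive points of a point module M, then
   the defining relations of the algebra, which hold in M, say that p and r span
   the left and right kernels of a 3 x 3 matrix of linear forms in q.  This
   matrix has rank 2, hence p and r are proportional to rows of minors, and
   substituting them in the trilinear form by which g acts on M gives a multiple
   of the equation of the cubic at q.  Thus g annihilates all the point modules,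
   so the image of g lies in the degree 3 part of the ideal generated by c_3,
   which is the line spanned by c_3.  This image is not 0: the invariant linear
   forms on words of degree 3 that vanish on the ideal of relations are those
   killed by tau, and tau and N are distinct points. *)

(** * Hesse cubics and the chord-tangent law *)

(** [opp2_pt] quantifies existentially over parametrised lines and homogeneous coordinates, and the
    conclusion concerns every representative of -2 tau. Exhibiting N is therefore not enough: third
    points must be unique up to a nonzero scalar. Two distinct points determine their secant, but a
    double point does not by itself determine a line; one has to show that a line on which F has a
    double root is killed by the gradient, hence is the tangent. Smoothness enters through two
    inequalities, abc nonzero and (a^3 + b^3 + c^3)^3 different from 27 (abc)^3. The second one
    recurs because abc ((a^3 + b^3 + c^3)^3 - 27 (abc)^3) is the one coefficient left when F is
    restricted to the tangent at O or at tau. No basis of the quotient algebra is computed: degree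
    arguments are made on representatives in the free algebra, using that the ideal of relations is
    graded. *)

Section HesseCubic.
Variable K : numFieldType.
Variables a b c : K.
Local Notation F := (hesse_cubic a b c).
Local Notation m := (a * b * c).
Local Notation sg := (a ^+ 3 + b ^+ 3 + c ^+ 3).

Lemma evalv_hesse v : evalv F v =
  m * (v 0 0 ^+ 3 + v 0 1 ^+ 3 + v 0 2 ^+ 3) - sg * (v 0 0 * v 0 1 * v 0 2).
Proof.
rewrite /evalv /hesse_cubic mpoly.mevalB !mpoly.mevalZ !mpoly.mevalD.
by rewrite !mpoly.mevalM !mpoly.mevalXU.
Qed.

Lemma meval_mderivXU n (i j : 'I_n) (v : 'I_n -> K) :
  mpoly.meval v (mpoly.mderiv i (mpoly.mpolyX K (mpoly.mnm1 j))) = (j == i)%:R.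
Proof.
rewrite mpoly.mderivX mpoly.mevalZ mpoly.mnm1E.
have [->|_] := eqVneq j i; last by rewrite mul0r.
rewrite -{1}[mpoly.mnm1 i]mpoly.add0m mpoly.addmK mpoly.mpolyX0.
by rewrite mpoly.meval1 mulr1.
Qed.

Lemma ord3P (i : 'I_3) : [\/ i = 0, i = 1 | i = 2].
Proof.
by case: i => [[|[|[|//]]] i3]; [apply: Or31 | apply: Or32 | apply: Or33];
  apply: val_inj.
Qed.

Lemma evalv_mderiv_hesse i v : evalv (mpoly.mderiv i F) v =
  m * (v 0 i ^+ 2 *+ 3)
  - sg * ((0 == i)%:R * v 0 1 * v 0 2 + (1 == i)%:R * v 0 0 * v 0 2
          + (2 == i)%:R * v 0 0 * v 0 1).
Proof.
have mderivX3 (j : 'I_3) : mpoly.meval (v 0) (mpoly.mderiv i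
    (mpoly.mpolyX K (mpoly.mnm1 j) ^+ 3)) = (j == i)%:R * (v 0 j ^+ 2 *+ 3).
  rewrite exprS expr2 !mpoly.mderivM mpoly.mevalD !mpoly.mevalM mpoly.mevalD.
  by rewrite !mpoly.mevalM meval_mderivXU mpoly.mevalXU; ring.
rewrite /evalv /hesse_cubic mpoly.mderivB !mpoly.mderivZ !mpoly.mderivD.
rewrite mpoly.mevalB !mpoly.mevalZ !mpoly.mevalD !mderivX3 !mpoly.mderivM.
rewrite mpoly.mevalD !mpoly.mevalM mpoly.mevalD !mpoly.mevalM !mpoly.mevalXU.
rewrite !meval_mderivXU.
have -> : v 0 i ^+ 2 *+ 3 = (0 == i)%:R * (v 0 0 ^+ 2 *+ 3)
   + (1 == i)%:R * (v 0 1 ^+ 2 *+ 3) + (2 == i)%:R * (v 0 2 ^+ 2 *+ 3).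
  by case: (ord3P i) => ->; rewrite -!val_eqE /= !(mul1r, mul0r, add0r, addr0).
ring.
Qed.

Lemma vec3E (x y z : K) : (vec3 x y z 0 0 = x) * (vec3 x y z 0 1 = y)
  * (vec3 x y z 0 2 = z).
Proof. by rewrite !mxE. Qed.

Lemma row3P (u v : 'rV[K]_3) :
  u 0 0 = v 0 0 -> u 0 1 = v 0 1 -> u 0 2 = v 0 2 -> u = v.
Proof.
by move=> e0 e1 e2; apply/rowP => i; case: (ord3P i) => ->.
Qed.

(** If abc = 0, the cubic is a multiple of the triangle XYZ, which is singular at the vertex
    [1:0:0]. *)
Lemma smooth_hesse_abc : smooth_curve F -> m != 0.
Proof.
move=> Fsm; apply/eqP => m0.
have v0 : vec3 1 0 0 != 0 :> 'rV[K]_3.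
  by apply/eqP => /rowP/(_ 0)/eqP; rewrite vec3E mxE oner_eq0.
case: (Fsm (vec3 1 0 0)) => [|i].
  by split=> //; rewrite evalv_hesse !vec3E m0; ring.
by rewrite evalv_mderiv_hesse !vec3E m0 => /eqP; case; ring.
Qed.

(** In case of equality k = sg / 3m is a cube root of unity. The gradient of X^3 + Y^3 + Z^3 - 3k
    XYZ vanishes where X^2 = kYZ, Y^2 = kXZ and Z^2 = kXY, for instance at [1:1:k^2]. *)
Lemma smooth_hesse_disc : smooth_curve F -> sg ^+ 3 != 27%:R * m ^+ 3.
Proof.
move=> Fsm; have m0 := smooth_hesse_abc Fsm; apply/eqP => disc.
have n3 : 3%:R != 0 :> K by rewrite Num.Theory.pnatr_eq0.
pose k := sg / (3%:R * m).
have sgE : sg = 3%:R * m * k by rewrite /k mulrC divfK // mulf_neq0.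
have k3 : k ^+ 3 = 1.
  have m3 : 27%:R * m ^+ 3 != 0.
    by rewrite mulf_neq0 ?expf_neq0 // Num.Theory.pnatr_eq0.
  apply: (mulfI m3); rewrite mulr1 -{2}disc sgE; ring.
pose v : 'rV[K]_3 := vec3 1 1 (k ^+ 2).
case: (Fsm v) => [|i].
  split; first by apply/eqP => /rowP/(_ 0)/eqP; rewrite vec3E mxE oner_eq0.
  rewrite evalv_hesse !vec3E sgE.
  have -> : (k ^+ 2) ^+ 3 = 1 by rewrite exprAC k3 expr1n.
  rewrite !expr1n !mul1r.
  have -> : 3%:R * m * k * k ^+ 2 = 3%:R * m * k ^+ 3 by ring.
  by rewrite k3; ring.
rewrite evalv_mderiv_hesse sgE => /eqP; case.
have kk : (k ^+ 2) ^+ 2 = k by rewrite -exprM (exprS _ 3) k3 mulr1.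
by case: (ord3P i) => ->; rewrite -!val_eqE /= !vec3E ?kk; ring: k3.
Qed.
End HesseCubic.

(** * Third points on secants and tangents: existence and uniqueness *)

Section LineSections.
Variable K : numFieldType.
Variable F : mpoly 3 K.

Lemma col_mx20 n (u v : 'rV[K]_n) j : (col_mx u v : 'M_(2, n)) 0 j = u 0 j.
Proof. by rewrite -(col_mxEu u v); congr (col_mx u v _ j); apply: val_inj. Qed.

Lemma col_mx21 n (u v : 'rV[K]_n) j : (col_mx u v : 'M_(2, n)) 1 j = v 0 j.
Proof. by rewrite -(col_mxEd u v); congr (col_mx u v _ j); apply: val_inj. Qed.

Lemma det_mx2 (A : 'M[K]_2) : \det A = A 0 0 * A 1 1 - A 0 1 * A 1 0.
Proof.
rewrite (expand_det_row _ 0) !big_ord_recl big_ord0 addr0 /cofactor !det_mx11.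
rewrite !mxE /= expr0 mul1r expr1 mulN1r mulrN.
by congr (_ * A _ _ - A _ _ * A _ _); apply: val_inj.
Qed.

Lemma det_col_mx2 (t p : 'rV[K]_2) :
  \det (col_mx t p : 'M_2) = t 0 0 * p 0 1 - t 0 1 * p 0 0.
Proof. by rewrite det_mx2 !col_mx20 !col_mx21. Qed.

Lemma mul_col_mx2 (t : 'rV[K]_2) (P Q : 'rV[K]_3) :
  t *m (col_mx P Q : 'M_(2, 3)) = t 0 0 *: P + t 0 1 *: Q.
Proof.
apply/rowP => j; rewrite !mxE !big_ord_recl big_ord0 addr0 col_mx20.
rewrite (_ : lift 0 0 = 1); last exact: val_inj.
by rewrite col_mx21.
Qed.
Lemma row2P (u v : 'rV[K]_2) : u 0 0 = v 0 0 -> u 0 1 = v 0 1 -> u = v.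
Proof.
move=> e0 e1; apply/rowP => -[[|[|//]] i2].
  by rewrite (_ : Ordinal i2 = 0) //; apply: val_inj.
by rewrite (_ : Ordinal i2 = 1) //; apply: val_inj.
Qed.

Lemma row_free_col_mx2 (P Q : 'rV[K]_3) i j :
  P 0 i * Q 0 j - P 0 j * Q 0 i != 0 -> row_free (col_mx P Q : 'M_(2, 3)).
Proof.
move=> PQ0; apply: inj_row_free => v; rewrite mul_col_mx2 => /rowP vPQ.
have := vPQ i; have := vPQ j; rewrite !mxE => vj vi.
have v0 : v 0 0 = 0.
  apply: (mulIf PQ0); rewrite mul0r.
  transitivity ((v 0 0 * P 0 i + v 0 1 * Q 0 i) * Q 0 j
    - (v 0 0 * P 0 j + v 0 1 * Q 0 j) * Q 0 i); first by ring.
  by rewrite vi vj !mul0r subrr.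
have v1 : v 0 1 = 0.
  apply: (mulIf PQ0); rewrite mul0r.
  transitivity ((v 0 0 * P 0 j + v 0 1 * Q 0 j) * P 0 i
    - (v 0 0 * P 0 i + v 0 1 * Q 0 i) * P 0 j); first by ring.
  by rewrite vi vj !mul0r subrr.
by apply: row2P; rewrite mxE.
Qed.

Lemma det_col_mx_neq0 (B : 'M[K]_(2, 3)) (p q : 'rV[K]_2) :
  row_free (col_mx (p *m B) (q *m B) : 'M_(2, 3)) ->
  \det (col_mx p q : 'M_2) != 0.
Proof.
rewrite -mul_col_mx -unitfE -unitmxE -row_free_unit /row_free.
rewrite !eqn_leq !rank_leq_row /= => /leq_trans; apply; exact: mxrankM_maxl.
Qed.

(** Cramer's rule for the parameters on a line. It recovers the third point from the two brackets
    that the restriction of the cubic determines. *)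
Lemma det_col_mx_cramer (B : 'M[K]_(2, 3)) (p q s : 'rV[K]_2) :
  \det (col_mx p q : 'M_2) *: (s *m B) =
  \det (col_mx p s : 'M_2) *: (q *m B) - \det (col_mx q s : 'M_2) *: (p *m B).
Proof.
rewrite !scalemxAl -mulmxBl; congr (_ *m B).
by apply: row2P; rewrite !mxE !det_col_mx2; ring.
Qed.

Lemma line_sectionC (P Q S : 'rV[K]_3) :
  line_section F P Q S -> line_section F Q P S.
Proof.
case=> cP cQ cS [B [p [q [s [k [fB k0 [PE QE SE] FB]]]]]].
split=> //; exists B, q, p, s, k; split=> // t.
by rewrite FB (mulrC (\det (col_mx t p))).
Qed.

Lemma line_sectionAC (P Q S : 'rV[K]_3) :
  line_section F P Q S -> line_section F P S Q.
Proof.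
case=> cP cQ cS [B [p [q [s [k [fB k0 [PE QE SE] FB]]]]]].
by split=> //; exists B, p, s, q, k; split=> // t; rewrite FB mulrAC.
Qed.

Lemma line_sectionZ (r : K) (P Q S : 'rV[K]_3) :
  evalv F (r *: P) = r ^+ 3 * evalv F P -> r != 0 ->
  line_section F P Q S -> line_section F (r *: P) Q S.
Proof.
move=> FrP r0 [[P0 cP] cQ cS [B [p [q [s [k [fB k0 [PE QE SE] FB]]]]]]].
split=> //; first by rewrite /on_curve scaler_eq0 negb_or r0 P0 FrP cP mulr0.
exists B, (r *: p), q, s, (k / r); split; rewrite ?mulf_neq0 ?invr_neq0 //.
  by rewrite PE QE SE scalemxAl.
by move=> t; rewrite FB !det_col_mx2 !mxE; field.
Qed.

Lemma line_section_mulmx (B : 'M[K]_(2, 3)) (p q s : 'rV[K]_2) (k : K) :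
  row_free B -> k != 0 -> p != 0 -> q != 0 -> s != 0 ->
  (forall t : 'rV[K]_2, evalv F (t *m B) =
     k * (\det (col_mx t p : 'M_2) * \det (col_mx t q : 'M_2)
          * \det (col_mx t s : 'M_2))) ->
  line_section F (p *m B) (q *m B) (s *m B).
Proof.
move=> fB k0 p0 q0 s0 FB.
have B0 (t : 'rV[K]_2) : t != 0 -> t *m B != 0 by rewrite mulmx_free_eq0.
have d0 (t : 'rV[K]_2) : \det (col_mx t t : 'M_2) = 0.
  by rewrite det_col_mx2; ring.
split; last by exists B, p, q, s, k.
- by split; rewrite ?B0 // FB d0 !mul0r mulr0.
- by split; rewrite ?B0 // FB d0 mulr0 mul0r mulr0.
- by split; rewrite ?B0 // FB d0 !mulr0.
Qed.

Definition row2 (x y : K) : 'rV[K]_2 := \row_j [:: x; y]`_j.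

Lemma row2E x y : (row2 x y 0 0 = x) * (row2 x y 0 1 = y).
Proof. by rewrite !mxE. Qed.

Lemma row2_eq0 x y : (row2 x y == 0) = (x == 0) && (y == 0).
Proof.
apply/eqP/andP => [/rowP xy0|[/eqP-> /eqP->]].
  by have := xy0 0; have := xy0 1; rewrite !mxE => /eqP-> /eqP->.
by apply: row2P; rewrite row2E mxE.
Qed.

Lemma mul_row2_col_mx x y (P Q : 'rV[K]_3) :
  row2 x y *m (col_mx P Q : 'M_(2, 3)) = x *: P + y *: Q.
Proof. by rewrite mul_col_mx2 !row2E. Qed.

(** Vanishing at P and Q leaves a residual linear factor ux + vy, whose root (v, -u) is the third
    parameter. *)
Lemma secant_line_section (P Q : 'rV[K]_3) (u v k : K) :
  row_free (col_mx P Q : 'M_(2, 3)) -> k != 0 -> (u != 0) || (v != 0) ->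
  (forall x y, evalv F (x *: P + y *: Q) = k * (x * y * (u * x + v * y))) ->
  line_section F P Q (v *: P - u *: Q).
Proof.
move=> fPQ k0 uv0 FPQ.
have -> : v *: P - u *: Q = row2 v (- u) *m (col_mx P Q : 'M_(2, 3)).
  by rewrite mul_row2_col_mx scaleNr.
have PE : P = row2 1 0 *m (col_mx P Q : 'M_(2, 3)).
  by rewrite mul_row2_col_mx scale1r scale0r addr0.
have QE : Q = row2 0 1 *m (col_mx P Q : 'M_(2, 3)).
  by rewrite mul_row2_col_mx scale1r scale0r add0r.
rewrite {1}PE {2}QE.
apply: (@line_section_mulmx _ _ _ _ k); rewrite ?row2_eq0 ?oner_eq0 ?andbF //.
  by rewrite oppr_eq0 andbC negb_and.
by move=> t; rewrite mul_col_mx2 FPQ !det_col_mx2 !row2E; ring.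
Qed.

(** [X] is any second point of the tangent at P; the factor y^2 records the double root at P. *)
Lemma tangent_line_section (P X : 'rV[K]_3) (u v k : K) :
  row_free (col_mx P X : 'M_(2, 3)) -> k != 0 -> (u != 0) || (v != 0) ->
  (forall x y, evalv F (x *: P + y *: X) = k * (y ^+ 2 * (u * x + v * y))) ->
  line_section F P P (v *: P - u *: X).
Proof.
move=> fPX k0 uv0 FPX.
have -> : v *: P - u *: X = row2 v (- u) *m (col_mx P X : 'M_(2, 3)).
  by rewrite mul_row2_col_mx scaleNr.
have PE : P = row2 1 0 *m (col_mx P X : 'M_(2, 3)).
  by rewrite mul_row2_col_mx scale1r scale0r addr0.
rewrite {1 2}PE.
apply: (@line_section_mulmx _ _ _ _ (- k));
  rewrite ?row2_eq0 ?oppr_eq0 ?oner_eq0 //.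
  by rewrite andbC negb_and.
by move=> t; rewrite mul_col_mx2 FPX !det_col_mx2 !row2E; ring.
Qed.

(** Whatever the parametrisation [B], the two factorisations of the same binary cubic can be
    compared after expressing [B] in terms of P and Q; d = det(p, q) is the change of
    coordinates. *)
Lemma secant_third_point (P Q S : 'rV[K]_3) (u v : K) :
  row_free (col_mx P Q : 'M_(2, 3)) ->
  (forall x y, evalv F (x *: P + y *: Q) = x * y * (u * x + v * y)) ->
  line_section F P Q S ->
  exists2 r, r != 0 & S = r *: (v *: P - u *: Q).
Proof.
move=> fPQ FPQ [_ _ _ [B [p [q [s [k [fB k0 [PE QE SE] FB]]]]]]].
have d0 : \det (col_mx p q : 'M_2) != 0.
  by apply: (@det_col_mx_neq0 B); rewrite -PE -QE.
set d := \det _ in d0.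
have FB' x y : x * y * (u * x + v * y) = - k * d ^+ 2 * x * y *
    (x * \det (col_mx p s : 'M_2) + y * \det (col_mx q s : 'M_2)).
  rewrite -FPQ PE QE !scalemxAl -mulmxDl FB /d !det_col_mx2 !mxE; ring.
(* The values at (1, 1) and (1, -1) give u + v and v - u, which separates the coefficients since 2
   is invertible. *)
have uE : u = - k * d ^+ 2 * \det (col_mx p s : 'M_2).
  have := FB' 1 1; have := FB' 1 (- 1).
  rewrite !mulr1 !mul1r => e1 e2.
  have n2 : 2%:R != 0 :> K by rewrite Num.Theory.pnatr_eq0.
  apply: (mulfI n2).
  transitivity ((u + v) - (-1 * (u + v * -1))); first by ring.
  by rewrite e1 e2; ring.
have vE : v = - k * d ^+ 2 * \det (col_mx q s : 'M_2).
  by have := FB' 1 1; rewrite !mulr1 !mul1r {1}uE mulrDr => /addrI.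
have dS := det_col_mx_cramer B p q s; rewrite -PE -QE -SE -/d in dS.
exists (k * d ^+ 3)^-1; first by rewrite invr_neq0 // mulf_neq0 // expf_neq0.
have kd0 : k * d ^+ 3 != 0 by rewrite mulf_neq0 // expf_neq0.
apply: (scalerI kd0); rewrite scalerA divff // scale1r uE vE.
rewrite exprSr mulrA -scalerA dS scalerBr !scalerA !mulNr !scaleNr opprK addrC.
by [].
Qed.

(** The vector [g] is the gradient at P, introduced by its role in the Taylor expansion. It forces
    the line [B] to be the tangent, after which the argument is that of the secant. *)
Lemma tangent_third_point (P X S : 'rV[K]_3) (g : 'cV[K]_3) (u v : K) :
  g != 0 ->
  (forall U, exists h, forall y, evalv F (P + y *: U) =
     y * (U *m g) 0 0 + y ^+ 2 * h + y ^+ 3 * evalv F U) ->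
  X *m g = 0 -> row_free (col_mx P X : 'M_(2, 3)) ->
  (forall x y, evalv F (x *: P + y *: X) = y ^+ 2 * (u * x + v * y)) ->
  line_section F P P S ->
  exists2 r, r != 0 & S = r *: (v *: P - u *: X).
Proof.
move=> g0 dF Xg fPX FPX [_ _ _ [B [p [q [s [k [fB k0 [PE QE SE] FB]]]]]]].
have qE : q = p.
  apply/eqP; rewrite -subr_eq0 -(mulmx_free_eq0 _ fB) mulmxBl.
  by rewrite -PE -QE subrr.
rewrite qE in FB.
(* On the line, F has a double root at P, so the linear term of its expansion at P vanishes in the
   direction of each row of [B]. *)
have Bg0 : B *m g = 0.
  apply/row_matrixP => i; rewrite row_mul row0.
  apply/matrixP => x y; rewrite !ord1 [RHS]mxE {x y}.
  have [h Fy] := dF (row i B); set e := (row i B *m g) 0 0 in Fy *.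
  rewrite rowE in Fy; set t : 'rV[K]_2 := delta_mx 0 i in Fy.
  have {}Fy y : y * e + y ^+ 2 * h + y ^+ 3 * evalv F (t *m B) =
      k * y ^+ 2 * \det (col_mx t p : 'M_2) ^+ 2
      * (\det (col_mx p s : 'M_2) + y * \det (col_mx t s : 'M_2)).
    rewrite -Fy {1}PE scalemxAl -mulmxDl FB !det_col_mx2 !mxE; ring.
  have := Fy 1; have := Fy (- 1); have := Fy 2%:R.
  set f := evalv F _.
  move=> F2 Fm F1.
  (* Extraction of the linear coefficient e from values G(y) of the cubic ey + hy^2 + fy^3: 6e =
     4(G(1) - G(-1)) - (G(2) - 2(G(1) + G(-1))). *)
  have n6 : 6%:R != 0 :> K by rewrite Num.Theory.pnatr_eq0.
  apply: (mulfI n6); rewrite mulr0.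
  transitivity (4%:R * (1 * e + 1 ^+ 2 * h + 1 ^+ 3 * f
                        - (- 1 * e + (- 1) ^+ 2 * h + (- 1) ^+ 3 * f))
    - ((2%:R * e + 2%:R ^+ 2 * h + 2%:R ^+ 3 * f)
       - 2%:R * ((1 * e + 1 ^+ 2 * h + 1 ^+ 3 * f)
           + (- 1 * e + (- 1) ^+ 2 * h + (- 1) ^+ 3 * f)))); first by ring.
  by rewrite F1 Fm F2; ring.
(* As g is nonzero, its kernel has rank 2 and so equals the row space of [B]. *)
have [n XE] : exists n, X = n *m B.
  apply/submxP; have BX : (B <= kermx g)%MS by apply/sub_kermxP.
  have /eqmxP eBX : (B == kermx g)%MS.
    rewrite -(mxrank_leqif_eq BX).2 mxrank_ker (eqP fB).
    suff -> : \rank g = 1 by [].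
    by apply/eqP; rewrite eqn_leq rank_leq_col lt0n mxrank_eq0.
  by rewrite eBX; apply/sub_kermxP.
have d0 : \det (col_mx p n : 'M_2) != 0.
  by apply: (@det_col_mx_neq0 B); rewrite -PE -XE.
set d := \det _ in d0.
have FB' x y : y ^+ 2 * (u * x + v * y) = k * d ^+ 2 * y ^+ 2 *
    (x * \det (col_mx p s : 'M_2) + y * \det (col_mx n s : 'M_2)).
  rewrite -FPX PE XE !scalemxAl -mulmxDl FB /d !det_col_mx2 !mxE; ring.
have vE : v = k * d ^+ 2 * \det (col_mx n s : 'M_2).
  by have := FB' 0 1; rewrite !expr1n !mulr1 !mul1r mulr0 mul0r !add0r.
have uE : u = k * d ^+ 2 * \det (col_mx p s : 'M_2).
  have := FB' 1 1; rewrite !expr1n !mulr1 !mul1r {1}vE mulrDr => /addIr.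
  by [].
have dS := det_col_mx_cramer B p n s; rewrite -PE -XE -SE -/d in dS.
have kd0 : - (k * d ^+ 3) != 0 by rewrite oppr_eq0 mulf_neq0 // expf_neq0.
exists (- (k * d ^+ 3))^-1; first by rewrite invr_neq0.
apply: (scalerI kd0); rewrite scalerA divff // scale1r uE vE.
rewrite scaleNr exprSr mulrA -scalerA dS scalerBr !scalerA opprB.
by [].
Qed.

End LineSections.

(** * Negation and doubling on a smooth Hesse cubic *)

Section HesseGroupLaw.
Variable K : numFieldType.
Variables a b c : K.
Local Notation F := (hesse_cubic a b c).
Local Notation m := (a * b * c).
Local Notation sg := (a ^+ 3 + b ^+ 3 + c ^+ 3).
Local Notation O := (vec3 1 (-1) 0 : 'rV[K]_3).
Local Notation tau := (vec3 a b c).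
Hypothesis Fsm : smooth_curve F.

(** The cubic is symmetric in X and Y, and P minus its image under this exchange is a multiple of O
    = [1:-1:0]. *)
Definition hesse_opp (P : 'rV[K]_3) : 'rV[K]_3 :=
  vec3 (P 0 1) (P 0 0) (P 0 2).

(* The third point of the cubic on the tangent line at P; it is independent of
   the member of the Hesse pencil through P. *)
Definition hesse_opp2 (P : 'rV[K]_3) : 'rV[K]_3 :=
  vec3 (P 0 0 * (P 0 1 ^+ 3 - P 0 2 ^+ 3)) (P 0 1 * (P 0 2 ^+ 3 - P 0 0 ^+ 3))
       (P 0 2 * (P 0 0 ^+ 3 - P 0 1 ^+ 3)).

Definition hesse_grad (P : 'rV[K]_3) : 'cV[K]_3 :=
  (vec3 (3%:R * m * P 0 0 ^+ 2 - sg * (P 0 1 * P 0 2))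
        (3%:R * m * P 0 1 ^+ 2 - sg * (P 0 0 * P 0 2))
        (3%:R * m * P 0 2 ^+ 2 - sg * (P 0 0 * P 0 1)))^T.

Lemma hesse_gradE (P U : 'rV[K]_3) : (U *m hesse_grad P) 0 0 =
  U 0 0 * (3%:R * m * P 0 0 ^+ 2 - sg * (P 0 1 * P 0 2))
  + U 0 1 * (3%:R * m * P 0 1 ^+ 2 - sg * (P 0 0 * P 0 2))
  + U 0 2 * (3%:R * m * P 0 2 ^+ 2 - sg * (P 0 0 * P 0 1)).
Proof.
rewrite mxE !big_ord_recl big_ord0 addr0 addrA !mxE /=.
by congr (U 0 _ * _ + U 0 _ * _ + U 0 _ * _); apply: val_inj.
Qed.

Lemma hesse_taylor (P U : 'rV[K]_3) : evalv F P = 0 ->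
  exists h, forall y, evalv F (P + y *: U) =
    y * (U *m hesse_grad P) 0 0 + y ^+ 2 * h + y ^+ 3 * evalv F U.
Proof.
move=> FP0; exists (3%:R * m * (P 0 0 * U 0 0 ^+ 2 + P 0 1 * U 0 1 ^+ 2
    + P 0 2 * U 0 2 ^+ 2)
  - sg * (P 0 0 * U 0 1 * U 0 2 + P 0 1 * U 0 0 * U 0 2 + P 0 2 * U 0 0 * U 0 1)).
by move=> y; rewrite -[LHS]subr0 -FP0 hesse_gradE !evalv_hesse !mxE; ring.
Qed.

Lemma evalv_hesseZ r (P : 'rV[K]_3) : evalv F (r *: P) = r ^+ 3 * evalv F P.
Proof. by rewrite !evalv_hesse !mxE; ring. Qed.

(* The second hypothesis is the equation of the tangent line at the flex O. *)
Lemma hesse_tangentO (P : 'rV[K]_3) : evalv F P = 0 ->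
  3%:R * m * (P 0 0 + P 0 1) + sg * P 0 2 = 0 -> P = P 0 0 *: O.
Proof.
move=> FP tP; have m0 := smooth_hesse_abc Fsm.
have disc := smooth_hesse_disc Fsm.
(* F = m((X + Y)^3 + Z^3) - XY(3m(X + Y) + sg Z), where the last factor is the tangent at O. *)
have eP : (P 0 0 + P 0 1) ^+ 3 = - P 0 2 ^+ 3.
  apply/eqP; rewrite -addr_eq0 -(mulrI_eq0 _ (mulfI m0)) -FP evalv_hesse.
  apply/eqP; rewrite -[RHS]addr0 -(mulr0 (P 0 0 * P 0 1)) -tP; ring.
have eT : sg ^+ 3 * P 0 2 ^+ 3 = 27%:R * m ^+ 3 * P 0 2 ^+ 3.
  have {}tP : sg * P 0 2 = - (3%:R * m * (P 0 0 + P 0 1)).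
    by apply/eqP; rewrite -addr_eq0 addrC tP.
  transitivity (- 27%:R * m ^+ 3 * (P 0 0 + P 0 1) ^+ 3); last by rewrite eP; ring.
  by rewrite -exprMn tP; ring.
have P2 : P 0 2 = 0.
  apply/eqP; apply: contraNT disc => P20.
  by apply/eqP; apply: (mulIf (expf_neq0 3 P20)).
have P01 : P 0 1 = - P 0 0.
  move/eqP: eP; rewrite P2 expr0n oppr0 expf_eq0 /= addrC addr_eq0.
  by move/eqP.
by apply: row3P; rewrite mxE vec3E ?P2 ?P01 ?mulr1 ?mulrN1 ?mulr0.
Qed.

Lemma O_neq0 : O != 0.
Proof. by apply/eqP => /rowP/(_ 0)/eqP; rewrite vec3E mxE oner_eq0. Qed.

Lemma O_curve : on_curve F O.
Proof. by split; [exact: O_neq0 | rewrite evalv_hesse !vec3E; ring]. Qed.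

(* A direction for the tangent line at O *)
Local Notation VO := (vec3 sg 0 (- (3%:R * m))).

Lemma row_free_O_VO : row_free (col_mx O VO : 'M_(2, 3)).
Proof.
apply: (@row_free_col_mx2 _ _ _ 0 2); rewrite !vec3E mul1r mul0r subr0.
rewrite oppr_eq0 mulf_neq0 ?(smooth_hesse_abc Fsm) //.
by rewrite Num.Theory.pnatr_eq0.
Qed.

(** The restriction is a multiple of y^3, so O is a flex. It is written as y^2(ux + vy) to fit the
    lemmas on tangents. *)
Lemma evalv_O_VO x y : evalv F (x *: O + y *: VO) =
  y ^+ 2 * (0 * x + m * (sg ^+ 3 - 27%:R * m ^+ 3) * y).
Proof. by rewrite evalv_hesse !mxE /=; ring. Qed.

Lemma evalv_O_secant (P : 'rV[K]_3) x y : on_curve F P ->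
  evalv F (x *: O + y *: P) =
  (3%:R * m * (P 0 0 + P 0 1) + sg * P 0 2)
  * (x * y * (1 * x + (P 0 0 - P 0 1) * y)).
Proof.
case=> _ FP; transitivity ((3%:R * m * (P 0 0 + P 0 1) + sg * P 0 2)
    * (x * y * (1 * x + (P 0 0 - P 0 1) * y)) + y ^+ 3 * evalv F P).
  by rewrite !evalv_hesse !mxE /=; ring.
by rewrite FP mulr0 addr0.
Qed.

(** The tangent at the flex O meets the cubic only at O. Off O, its equation is thus nonzero at P,
    and it is the constant factor of F on the secant through O and P. *)
Lemma curve_O_dicho (P : 'rV[K]_3) : on_curve F P ->
  (exists2 r, r != 0 & P = r *: O) \/
  (row_free (col_mx O P : 'M_(2, 3)) /\
   3%:R * m * (P 0 0 + P 0 1) + sg * P 0 2 != 0).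
Proof.
case=> P0 FP.
have [/(hesse_tangentO FP) PO|tP] :=
  eqVneq (3%:R * m * (P 0 0 + P 0 1) + sg * P 0 2) 0.
  left; exists (P 0 0) => //; apply: contra_neq P0 => P00.
  by rewrite PO P00 scale0r.
right; split=> //; apply: contraNT tP => PnO.
have [P2|P2] := eqVneq (P 0 2) 0; last first.
  case/negP: PnO; apply: (@row_free_col_mx2 _ _ _ 0 2).
  by rewrite !vec3E mul1r mul0r subr0.
have [P01|P01] := eqVneq (P 0 0 + P 0 1) 0; first by rewrite P01 P2 !mulr0 addr0.
case/negP: PnO; apply: (@row_free_col_mx2 _ _ _ 0 1).
by rewrite !vec3E mul1r mulN1r opprK addrC.
Qed.

Lemma line_section_OO : line_section F O O O.
Proof.
have m0 := smooth_hesse_abc Fsm; have disc := smooth_hesse_disc Fsm.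
have k0 : m * (sg ^+ 3 - 27%:R * m ^+ 3) != 0 by rewrite mulf_neq0 // subr_eq0.
have : line_section F O O (1 *: O - 0 *: VO).
  apply: (@tangent_line_section _ _ _ _ _ _ _ row_free_O_VO k0).
    by rewrite oner_eq0 orbT.
  by move=> x y; rewrite evalv_O_VO; ring.
by rewrite scale1r scale0r subr0.
Qed.

Lemma line_section_O_opp (P : 'rV[K]_3) :
  on_curve F P -> line_section F O P (hesse_opp P).
Proof.
move=> cP; case: (curve_O_dicho cP) => [[r r0 PE]|[fP tP]].
  have -> : hesse_opp P = - r *: O.
    by rewrite PE; apply: row3P; rewrite !mxE /=; ring.
  rewrite PE; apply/line_sectionC/line_sectionZ => //; first exact: evalv_hesseZ.
  apply/line_sectionC/line_sectionAC/line_sectionC/line_sectionZ.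
  - exact: evalv_hesseZ.
  - by rewrite oppr_eq0.
  exact: line_section_OO.
have -> : hesse_opp P = -1 *: ((P 0 0 - P 0 1) *: O - 1 *: P).
  by apply: row3P; rewrite !mxE /=; ring.
apply/line_sectionC/line_sectionAC/line_sectionC/line_sectionZ.
- exact: evalv_hesseZ.
- by rewrite oppr_eq0 oner_eq0.
apply/line_sectionC/line_sectionAC/line_sectionC.
apply: (secant_line_section fP tP); first by rewrite oner_eq0.
by move=> x y; exact: evalv_O_secant.
Qed.

Lemma line_section_O_uniq (P S : 'rV[K]_3) :
  line_section F O P S -> exists2 r, r != 0 & S = r *: hesse_opp P.
Proof.
move=> lP; have [_ cP _ _] := lP.
have m0 := smooth_hesse_abc Fsm; have disc := smooth_hesse_disc Fsm.
have k0 : m * (sg ^+ 3 - 27%:R * m ^+ 3) != 0 by rewrite mulf_neq0 // subr_eq0.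
case: (curve_O_dicho cP) => [[r r0 PE]|[fP tP]].
  have {}lP : line_section F O O S.
    rewrite -[O in line_section _ _ O](scalerK r0) -PE.
    apply/line_sectionC/line_sectionZ; rewrite ?evalv_hesseZ ?invr_eq0 //.
    exact: line_sectionC.
  have [_ FO] := O_curve.
  have [|||u u0 SE] := @tangent_third_point _ F O VO S (hesse_grad O) 0
      (m * (sg ^+ 3 - 27%:R * m ^+ 3)) _ _ _ row_free_O_VO evalv_O_VO lP.
  - have m30 : 3%:R * m != 0 by rewrite mulf_neq0 // Num.Theory.pnatr_eq0.
    apply: contra_neq m30 => /(congr1 (fun M : 'cV_3 => M 0 0)).
    by rewrite !mxE /= => gO; rewrite -[RHS]gO; ring.
  - by move=> U; apply: hesse_taylor.
  - by apply/matrixP => i j; rewrite !ord1 [RHS]mxE hesse_gradE !vec3E; ring.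
  exists (- u * (m * (sg ^+ 3 - 27%:R * m ^+ 3)) / r).
    by rewrite mulf_neq0 ?invr_eq0 // mulf_neq0 ?oppr_eq0.
  by rewrite SE PE; apply: row3P; rewrite !mxE /=; field.
have [|u u0 SE] := @secant_third_point _ F O P S
  (3%:R * m * (P 0 0 + P 0 1) + sg * P 0 2)
  ((3%:R * m * (P 0 0 + P 0 1) + sg * P 0 2) * (P 0 0 - P 0 1)) fP _ lP.
  by move=> x y; rewrite evalv_O_secant //; ring.
exists (- (u * (3%:R * m * (P 0 0 + P 0 1) + sg * P 0 2))).
  by rewrite oppr_eq0 mulf_neq0.
by rewrite SE; apply: row3P; rewrite !mxE /=; ring.
Qed.

(** Only xy^2 survives: the line is tangent at tau, and its residual point is [hesse_opp2 tau]. *)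
Lemma evalv_tau_opp2 x y : evalv F (x *: tau + y *: hesse_opp2 tau) =
  y ^+ 2 * (m * (sg ^+ 3 - 27%:R * m ^+ 3) * x + 0 * y).
Proof. by rewrite evalv_hesse !mxE /=; ring. Qed.

(** Given abc nonzero, equality of the three cubes is exactly the vanishing of [hesse_opp2 tau]. *)
Lemma smooth_hesse_cubes : ~ (a ^+ 3 = b ^+ 3 /\ b ^+ 3 = c ^+ 3).
Proof.
case=> ab bc; move/eqP: (smooth_hesse_disc Fsm); case.
by rewrite !exprMn ab bc; ring.
Qed.

(** This says that 3 tau is not 0, the flexes being the points with a zero coordinate. The minors
    are, up to sign, ab(2c^3 - a^3 - b^3) and its analogues; two of them vanish together only if a^3
    = b^3 = c^3. *)
Lemma row_free_tau_opp2 : row_free (col_mx tau (hesse_opp2 tau) : 'M_(2, 3)).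
Proof.
have := smooth_hesse_abc Fsm; rewrite !mulf_eq0 !negb_or -andbA.
case/and3P=> a0 b0 c0.
have n3 : 3%:R != 0 :> K by rewrite Num.Theory.pnatr_eq0.
have [e1|e1] := eqVneq (c ^+ 3 *+ 2 - a ^+ 3 - b ^+ 3) 0; last first.
  apply: (@row_free_col_mx2 _ _ _ 0 1); rewrite !vec3E.
  have -> : a * (b * (c ^+ 3 - a ^+ 3)) - b * (a * (b ^+ 3 - c ^+ 3)) =
    a * b * (c ^+ 3 *+ 2 - a ^+ 3 - b ^+ 3) by ring.
  by rewrite !mulf_neq0.
have [e2|e2] := eqVneq (b ^+ 3 *+ 2 - a ^+ 3 - c ^+ 3) 0; last first.
  apply: (@row_free_col_mx2 _ _ _ 2 0); rewrite !vec3E.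
  have -> : c * (a * (b ^+ 3 - c ^+ 3)) - a * (c * (a ^+ 3 - b ^+ 3)) =
    a * c * (b ^+ 3 *+ 2 - a ^+ 3 - c ^+ 3) by ring.
  by rewrite !mulf_neq0.
have bc : b ^+ 3 = c ^+ 3.
  apply: (mulfI n3); apply/eqP; rewrite -subr_eq0; apply/eqP.
  by transitivity ((b ^+ 3 *+ 2 - a ^+ 3 - c ^+ 3)
    - (c ^+ 3 *+ 2 - a ^+ 3 - b ^+ 3)); [ring | rewrite e1 e2 subrr].
case: smooth_hesse_cubes; split=> //.
apply/eqP; rewrite eq_sym -subr_eq0 -e2 -bc; apply/eqP; ring.
Qed.

Lemma hesse_opp2_tau_curve : on_curve F (hesse_opp2 tau).
Proof.
split; last first.
  have := evalv_tau_opp2 0 1; rewrite scale0r scale1r add0r => ->; ring.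
apply/negP => /eqP e; have /row_free_inj inj := row_free_tau_opp2.
have /inj/rowP/(_ 1)/eqP : row2 0 1 *m (col_mx tau (hesse_opp2 tau) : 'M_(2, 3))
    = 0 *m (col_mx tau (hesse_opp2 tau) : 'M_(2, 3)).
  by rewrite mul_row2_col_mx scale0r scale1r add0r mul0mx.
by rewrite row2E mxE oner_eq0.
Qed.

Lemma line_section_tau : line_section F tau tau (hesse_opp2 tau).
Proof.
have m0 := smooth_hesse_abc Fsm; have disc := smooth_hesse_disc Fsm.
have k0 : - (m * (sg ^+ 3 - 27%:R * m ^+ 3)) != 0.
  by rewrite oppr_eq0 mulf_neq0 // subr_eq0.
have -> : hesse_opp2 tau = 0 *: tau - (-1) *: hesse_opp2 tau.
  by rewrite scale0r add0r scaleN1r opprK.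
apply: (tangent_line_section row_free_tau_opp2 k0).
  by rewrite oppr_eq0 oner_eq0.
by move=> x y; rewrite evalv_tau_opp2; ring.
Qed.

Lemma line_section_tau_uniq (S : 'rV[K]_3) :
  line_section F tau tau S -> exists2 r, r != 0 & S = r *: hesse_opp2 tau.
Proof.
move=> lS; have [[_ Ftau] _ _ _] := lS.
have m0 := smooth_hesse_abc Fsm; have disc := smooth_hesse_disc Fsm.
have k0 : m * (sg ^+ 3 - 27%:R * m ^+ 3) != 0 by rewrite mulf_neq0 // subr_eq0.
have := m0; rewrite !mulf_eq0 !negb_or -andbA; case/and3P=> a0 b0 c0.
have [|||u u0 SE] := @tangent_third_point _ F tau (hesse_opp2 tau) S
  (hesse_grad tau) (m * (sg ^+ 3 - 27%:R * m ^+ 3)) 0 _ _ _ row_free_tau_opp2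
  evalv_tau_opp2 lS.
(* The gradient at tau has the components bc(3a^3 - sg), ac(3b^3 - sg) and ab(3c^3 - sg). *)
- apply/eqP => g0; apply: smooth_hesse_cubes.
  have gE i : (hesse_grad tau) i 0 = 0 by rewrite g0 mxE.
  have := gE 0; have := gE 1; have := gE 2; rewrite !mxE /= => g2 g1 g'0.
  have e0 : 3%:R * a ^+ 3 = sg.
    apply: (mulfI (mulf_neq0 b0 c0)); apply/eqP; rewrite -subr_eq0; apply/eqP.
    by rewrite -[RHS]g'0; ring.
  have e1 : 3%:R * b ^+ 3 = sg.
    apply: (mulfI (mulf_neq0 a0 c0)); apply/eqP; rewrite -subr_eq0; apply/eqP.
    by rewrite -[RHS]g1; ring.
  have e2 : 3%:R * c ^+ 3 = sg.
    apply: (mulfI (mulf_neq0 a0 b0)); apply/eqP; rewrite -subr_eq0; apply/eqP.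
    by rewrite -[RHS]g2; ring.
  have n3 : 3%:R != 0 :> K by rewrite Num.Theory.pnatr_eq0.
  by split; apply: (mulfI n3); rewrite ?e0 ?e1 ?e2.
- by move=> U; apply: hesse_taylor.
- by apply/matrixP => i j; rewrite !ord1 [RHS]mxE hesse_gradE !vec3E; ring.
exists (- (u * (m * (sg ^+ 3 - 27%:R * m ^+ 3)))).
  by rewrite oppr_eq0 mulf_neq0.
by rewrite SE scale0r sub0r scalerN scalerA scaleNr.
Qed.

(** The double D of tau is the negative of the tangential point N. In D + W = O, the third point of
    the line through D and W must be O, because O is a flex; hence W is the negative of D, which is
    N again. *)
Lemma opp2_ptP (W : 'rV[K]_3) : tau != 0 ->
  opp2_pt F O tau W <-> exists2 r, r != 0 & W = r *: hesse_opp2 tau.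
Proof.
move=> tau0; split=> [[D [[N [tN ND]] [N' [DW N'O]]]]|[r r0 ->]].
  have [r1 r10 NE] := line_section_tau_uniq tN.
  have [r2 r20 DE] := line_section_O_uniq ND.
  have [r3 r30 N'E] := line_section_O_uniq (line_sectionAC N'O).
  have {}N'E : N' = - r3 *: O by rewrite N'E; apply: row3P; rewrite !mxE /=; ring.
  have r3N : - r3 != 0 by rewrite oppr_eq0.
  have {DW} : line_section F O D W.
    rewrite -[O](scalerK r3N) -N'E.
    apply: line_sectionZ; rewrite ?evalv_hesseZ ?invr_eq0 //.
    exact: (line_sectionC (line_sectionAC DW)).
  case/line_section_O_uniq=> r4 r40 WE.
  exists (r4 * r2 * r1); first by rewrite !mulf_neq0.
  by rewrite WE DE NE; apply: row3P; rewrite !mxE /=; ring.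
have cN := hesse_opp2_tau_curve.
exists (hesse_opp (hesse_opp2 tau)); split.
  exists (hesse_opp2 tau); split; first exact: line_section_tau.
  exact: line_section_O_opp.
exists O; split; last exact: line_section_OO.
apply/line_sectionC/line_sectionZ => //; first exact: evalv_hesseZ.
exact/line_sectionAC/line_sectionC/line_section_O_opp.
Qed.

End HesseGroupLaw.

(** * Consecutive points of a point module *)

Section PointModuleRelations.
Variable K : numFieldType.

(** [A] is the cross product of X and Y, and r x (X x Y) = (r.Y) X - (r.X) Y vanishes. *)
Lemma cross_kernel (X Y r : 'rV[K]_3) :
  let A := vec3 (X 0 1 * Y 0 2 - X 0 2 * Y 0 1)
    (X 0 2 * Y 0 0 - X 0 0 * Y 0 2) (X 0 0 * Y 0 1 - X 0 1 * Y 0 0) in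
  X 0 0 * r 0 0 + X 0 1 * r 0 1 + X 0 2 * r 0 2 = 0 ->
  Y 0 0 * r 0 0 + Y 0 1 * r 0 1 + Y 0 2 * r 0 2 = 0 ->
  A != 0 -> exists l, r = l *: A.
Proof.
move=> A Xr Yr A0.
have rA i j : r 0 i * A 0 j = r 0 j * A 0 i.
  have rA01 : r 0 0 * A 0 1 = r 0 1 * A 0 0.
    rewrite !vec3E; apply/eqP; rewrite -subr_eq0; apply/eqP.
    transitivity (Y 0 2 * -(X 0 0 * r 0 0 + X 0 1 * r 0 1 + X 0 2 * r 0 2)
      + X 0 2 * (Y 0 0 * r 0 0 + Y 0 1 * r 0 1 + Y 0 2 * r 0 2)); first by ring.
    by rewrite Xr Yr; ring.
  have rA02 : r 0 0 * A 0 2 = r 0 2 * A 0 0.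
    rewrite !vec3E; apply/eqP; rewrite -subr_eq0; apply/eqP.
    transitivity (Y 0 1 * (X 0 0 * r 0 0 + X 0 1 * r 0 1 + X 0 2 * r 0 2)
      - X 0 1 * (Y 0 0 * r 0 0 + Y 0 1 * r 0 1 + Y 0 2 * r 0 2)); first by ring.
    by rewrite Xr Yr; ring.
  have rA12 : r 0 1 * A 0 2 = r 0 2 * A 0 1.
    rewrite !vec3E; apply/eqP; rewrite -subr_eq0; apply/eqP.
    transitivity (Y 0 0 * -(X 0 0 * r 0 0 + X 0 1 * r 0 1 + X 0 2 * r 0 2)
      + X 0 0 * (Y 0 0 * r 0 0 + Y 0 1 * r 0 1 + Y 0 2 * r 0 2)); first by ring.
    by rewrite Xr Yr; ring.
  by case: (ord3P i) (ord3P j) => -> [] ->.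
have [i Ai] : exists i, A 0 i != 0.
  apply/existsP; apply: contraNT A0 => /existsPn A0.
  by apply/eqP/rowP => i; rewrite [RHS]mxE; apply/eqP/negPn/A0.
exists (r 0 i / A 0 i); apply/rowP => j; rewrite [RHS]mxE.
by rewrite mulrAC rA mulfK.
Qed.

Definition bilin_rel (a b c : K) (u v : 'rV[K]_3) : Prop :=
  [/\ a * (u 0 1 * v 0 2) + b * (u 0 2 * v 0 1) + c * (u 0 0 * v 0 0) = 0,
      a * (u 0 2 * v 0 0) + b * (u 0 0 * v 0 2) + c * (u 0 1 * v 0 1) = 0
    & a * (u 0 0 * v 0 1) + b * (u 0 1 * v 0 0) + c * (u 0 2 * v 0 2) = 0].

(* Cross products of the rows of the matrix of the linear system
   bilin_rel a b c q r in the unknown r. *)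
Definition bilin_minor (a b c : K) (q : 'rV[K]_3) (i : 'I_3) : 'rV[K]_3 :=
  let x := q 0 0 in let y := q 0 1 in let z := q 0 2 in
  if i == 0 then vec3 (b ^+ 2 * (x * z) - a * c * y ^+ 2)
    (a ^+ 2 * (y * z) - b * c * x ^+ 2) (c ^+ 2 * (x * y) - a * b * z ^+ 2)
  else if i == 1 then vec3 (c ^+ 2 * (y * z) - a * b * x ^+ 2)
    (b ^+ 2 * (x * y) - a * c * z ^+ 2) (a ^+ 2 * (x * z) - b * c * y ^+ 2)
  else vec3 (a ^+ 2 * (x * y) - b * c * z ^+ 2)
    (c ^+ 2 * (x * z) - a * b * y ^+ 2) (b ^+ 2 * (y * z) - a * c * x ^+ 2).

(** Rank 2 holds at every point of the plane. If all minors vanish, then x = 0 gives y = z = 0,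
    while x nonzero gives yz nonzero and a^3 yz = b^3 yz = c^3 yz = abc x^2. *)
Lemma bilin_minor_neq0 (a b c : K) (q : 'rV[K]_3) : a * b * c != 0 ->
  ~ (a ^+ 3 = b ^+ 3 /\ b ^+ 3 = c ^+ 3) -> q != 0 ->
  exists i, bilin_minor a b c q i != 0.
Proof.
rewrite !mulf_eq0 !negb_or -andbA; case/and3P=> a0 b0 c0 abc q0.
apply/existsP; apply: contraNT q0 => /existsPn A0.
have {}A0 i : bilin_minor a b c q i = 0 by apply/eqP/negPn/A0.
have e i j : bilin_minor a b c q i 0 j = 0 by rewrite A0 mxE.
have := e 0 0; have := e 0 1; have := e 1 0; have := e 1 1; have := e 2 2.
rewrite {e A0} /bilin_minor !eqxx -!val_eqE /= !vec3E.
set x := q 0 0; set y := q 0 1; set z := q 0 2 => e22 e11 e10 e01 e00.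
have [x0|x0] := eqVneq x 0.
  have y0 : y = 0.
    have : - (a * c * y ^+ 2) = 0 by rewrite -[RHS]e00 x0; ring.
    by move/eqP; rewrite oppr_eq0 mulf_eq0 expf_eq0 /= mulf_eq0 (negbTE a0)
      (negbTE c0) => /eqP.
  have z0 : z = 0.
    have : - (a * c * z ^+ 2) = 0 by rewrite -[RHS]e11 x0; ring.
    by move/eqP; rewrite oppr_eq0 mulf_eq0 expf_eq0 /= mulf_eq0 (negbTE a0)
      (negbTE c0) => /eqP.
  by rewrite (_ : q = 0) //; apply: row3P; rewrite mxE.
have yz0 : y * z != 0.
  apply: contra_eq_neq e01 => ->.
  by rewrite mulr0 sub0r oppr_eq0 !mulf_neq0.
case: abc; split; apply: (mulIf yz0); apply/eqP; rewrite -subr_eq0; apply/eqP.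
  transitivity (a * (a ^+ 2 * (y * z) - b * c * x ^+ 2)
    - b * (b ^+ 2 * (y * z) - a * c * x ^+ 2)); first by ring.
  by rewrite e22 e01 !mulr0 subrr.
transitivity (b * (b ^+ 2 * (y * z) - a * c * x ^+ 2)
  - c * (c ^+ 2 * (y * z) - a * b * x ^+ 2)); first by ring.
by rewrite e22 e10 !mulr0 subrr.
Qed.

Lemma bilin_relP (a b c : K) (q r : 'rV[K]_3) (i : 'I_3) :
  bilin_rel a b c q r -> bilin_minor a b c q i != 0 ->
  exists l, r = l *: bilin_minor a b c q i.
Proof.
pose X0 := vec3 (c * q 0 0) (b * q 0 2) (a * q 0 1).
pose X1 := vec3 (a * q 0 2) (c * q 0 1) (b * q 0 0).
pose X2 := vec3 (b * q 0 1) (a * q 0 0) (c * q 0 2).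
case=> r0 r1 r2.
have {r0} : X0 0 0 * r 0 0 + X0 0 1 * r 0 1 + X0 0 2 * r 0 2 = 0.
  by rewrite !vec3E -r0; ring.
have {r1} : X1 0 0 * r 0 0 + X1 0 1 * r 0 1 + X1 0 2 * r 0 2 = 0.
  by rewrite !vec3E -r1; ring.
have {r2} : X2 0 0 * r 0 0 + X2 0 1 * r 0 1 + X2 0 2 * r 0 2 = 0.
  by rewrite !vec3E -r2; ring.
move=> r2 r1 r0; case: (ord3P i) => ->; rewrite /bilin_minor -!val_eqE /=.
- have := cross_kernel r0 r1; rewrite /= !vec3E.
  set A := vec3 _ _ _; set A' := vec3 _ _ _.
  by have -> : A = A' by apply: row3P; rewrite !vec3E; ring.
- have := cross_kernel r1 r2; rewrite /= !vec3E.
  set A := vec3 _ _ _; set A' := vec3 _ _ _.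
  by have -> : A = A' by apply: row3P; rewrite !vec3E; ring.
have := cross_kernel r2 r0; rewrite /= !vec3E.
set A := vec3 _ _ _; set A' := vec3 _ _ _.
by have -> : A = A' by apply: row3P; rewrite !vec3E; ring.
Qed.

(** The multilinear form of al f1 + be f2 + ga f3: successive letters of a word are evaluated at p,
    q and r. *)
Definition c3_form (al be ga : K) (p q r : 'rV[K]_3) : K :=
  al * (p 0 2 * q 0 0 * r 0 1 + p 0 0 * q 0 1 * r 0 2 + p 0 1 * q 0 2 * r 0 0)
  + be * (p 0 1 * q 0 0 * r 0 2 + p 0 2 * q 0 1 * r 0 0 + p 0 0 * q 0 2 * r 0 1)
  + ga * (p 0 0 * q 0 0 * r 0 0 + p 0 1 * q 0 1 * r 0 1 + p 0 2 * q 0 2 * r 0 2).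

Lemma c3_form_point (a b c : K) (p q r : 'rV[K]_3) :
  smooth_curve (hesse_cubic a b c) -> on_curve (hesse_cubic a b c) q ->
  bilin_rel a b c p q -> bilin_rel a b c q r ->
  c3_form (a * (b ^+ 3 - c ^+ 3)) (b * (c ^+ 3 - a ^+ 3))
    (c * (a ^+ 3 - b ^+ 3)) p q r = 0.
Proof.
move=> sm [q0 Fq] pq qr.
have abc0 := smooth_hesse_abc sm; have abc := smooth_hesse_cubes sm.
have [j Aj] := bilin_minor_neq0 abc0 abc q0.
(* Exchanging a and b transposes the three bilinear forms, so p is described by the minors for
   [b:a:c] just as r is by those for [a:b:c]. *)
have bac0 : b * a * c != 0 by rewrite (mulrC b).
have bac : ~ (b ^+ 3 = a ^+ 3 /\ a ^+ 3 = c ^+ 3).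
  by case=> ba ac; apply: abc; rewrite ba ac.
have [i Bi] := bilin_minor_neq0 bac0 bac q0.
have [l ->] := bilin_relP qr Aj.
have qp : bilin_rel b a c q p.
  by case: pq => e0 e1 e2; split; [rewrite -e0|rewrite -e1|rewrite -e2]; ring.
have [l' ->] := bilin_relP qp Bi.
move: Fq; rewrite evalv_hesse => Fq {Aj Bi qr qp pq q0}.
(* With two quadratic minors substituted, the form has degree 5 in q. For each of the nine choices
   of minors it is the cubic times an explicit quadratic cofactor. *)
pose x := q 0 0; pose y := q 0 1; pose z := q 0 2.
pose d1 := b ^+ 3 - c ^+ 3; pose d2 := c ^+ 3 - a ^+ 3; pose d3 := a ^+ 3 - b ^+ 3.
pose Qa u v := (a ^+ 2 * v *+ 2 + b * c * u ^+ 2) * d1.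
pose Qb u v := (b ^+ 2 * v *+ 2 + a * c * u ^+ 2) * d2.
pose Qc u v := (c ^+ 2 * v *+ 2 + a * b * u ^+ 2) * d3.
(* The form takes the value l * l' * Q i j * F(q). *)
pose Q (i j : 'I_3) : K := nth 0 (nth [::]
  [:: [:: Qc z (x * y); Qa y (x * z); Qb x (y * z)];
      [:: Qb y (x * z); Qc x (y * z); Qa z (x * y)];
      [:: Qa x (y * z); Qb z (x * y); Qc y (x * z)]] i) j.
apply: etrans (mulr0 (l * l' * Q i j)); rewrite -[X in _ = _ * X]Fq.
rewrite /Q /Qa /Qb /Qc /d1 /d2 /d3 /x /y /z {Q Qa Qb Qc d1 d2 d3 x y z}.
by case: (ord3P i) (ord3P j) => -> [] ->;
  rewrite /c3_form /bilin_minor -!val_eqE /= !mxE /=; ring.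
Qed.

End PointModuleRelations.

(** * The free algebra and the ideal of relations *)

Section MalgExtension.
Variable K : comNzRingType.
Local Notation free3 := {malg K[{fmonom 'I_3}]}.

Lemma malg_ind (P : free3 -> Prop) : P 0 ->
  (forall u v, P u -> P v -> P (u + v)) ->
  (forall k (w : {fmonom 'I_3}), P << k *g w >>) -> forall u, P u.
Proof. by move=> P0 PD PU u; rewrite [u]monalgE; apply: big_ind. Qed.

(** Additivity is a hypothesis on bare functions, so that any expression depending additively on one
    variable qualifies without a morphism structure. *)
Lemma malg_ext (V : zmodType) (f g : free3 -> V) :
  {morph f : u v / u + v} -> {morph g : u v / u + v} ->
  (forall k (w : {fmonom 'I_3}), f << k *g w >> = g << k *g w >>) -> f =1 g.
Proof.
move=> fD gD fgU.
have zeroE (h : free3 -> V) : {morph h : u v / u + v} -> h 0 = 0.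
  by move=> hD; apply: (addIr (h 0)); rewrite -hD addr0 add0r.
elim/malg_ind=> [|u v eu ev|//]; first by rewrite !zeroE.
by rewrite fD gD eu ev.
Qed.

Lemma malgUM k l (v w : {fmonom 'I_3}) :
  << k *g v >> * << l *g w >> = << k * l *g mmul v w >> :> free3.
Proof. by rewrite malgM_def fgmulUU. Qed.

Lemma malgZU k l (w : {fmonom 'I_3}) :
  k *: << l *g w >> = << k * l *g w >> :> free3.
Proof.
apply/malgP => v; rewrite mcoeffZ; transitivity (k * (l *+ (w == v))).
  by congr (_ * _); exact: mcoeffU.
by rewrite mulrnAr mcoeffU.
Qed.

(** Scalars are central because the coefficient ring is commutative. *)
Lemma malg_mulrZ k (u v : free3) : u * (k *: v) = k *: (u * v).
Proof.
apply: (malg_ext (f := fun u => u * (k *: v)) (g := fun u => k *: (u * v))).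
- by move=> u1 u2; exact: mulrDl.
- by move=> u1 u2; rewrite mulrDl; exact: scalerDr.
move=> l w /=.
apply: (malg_ext (f := fun v => << l *g w >> * (k *: v))
                 (g := fun v => k *: (<< l *g w >> * v))).
- by move=> v1 v2; rewrite scalerDr; exact: mulrDr.
- by move=> v1 v2; rewrite mulrDr; exact: scalerDr.
move=> l' w' /=; transitivity (<< l *g w >> * << k * l' *g w' >>).
  by congr (_ * _); exact: malgZU.
rewrite malgUM mulrCA; symmetry; transitivity (k *: << l * l' *g mmul w w' >>).
  by congr (_ *: _); exact: malgUM.
exact: malgZU.
Qed.

End MalgExtension.

Section FreeAlgebra.
Variable R : realType.
Local Notation C := R[i].
Local Notation free3 := (free_alg R).

Lemma lin_substD A : {morph @lin_subst R A : u v / u + v}.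
Proof. exact: mmapD. Qed.

Lemma lin_subst0 A : @lin_subst R A 0 = 0.
Proof. exact: mmap0. Qed.

Lemma lin_substU A k (w : {fmonom 'I_3}) : lin_subst A << k *g w >> =
  k *: \prod_(j <- (w : seq 'I_3)) \sum_i A i j *: gen3 R i.
Proof. by rewrite /lin_subst mmapU mulr_algl. Qed.

Lemma lin_substZ A k u : @lin_subst R A (k *: u) = k *: lin_subst A u.
Proof.
apply: (malg_ext (f := fun u => lin_subst A (k *: u))
                 (g := fun u => k *: lin_subst A u)).
- by move=> u1 u2; rewrite scalerDr; exact: lin_substD.
- by move=> u1 u2; rewrite lin_substD; exact: scalerDr.
move=> l w; transitivity (lin_subst A << k * l *g w >>).
  by congr lin_subst; exact: malgZU.
rewrite lin_substU -scalerA; congr (_ *: _).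
by rewrite lin_substU.
Qed.

Lemma lin_subst1 A : @lin_subst R A 1 = 1.
Proof.
rewrite [1 in LHS](_ : _ = << 1 *g fmone _ >>) // lin_substU fm1 big_nil.
exact: scale1r.
Qed.

Lemma lin_substM A : {morph @lin_subst R A : u v / u * v}.
Proof.
move=> u v; apply: (malg_ext (f := fun u => lin_subst A (u * v))
                             (g := fun u => lin_subst A u * lin_subst A v)).
- by move=> u1 u2; rewrite mulrDl; exact: lin_substD.
- by move=> u1 u2; rewrite lin_substD; exact: mulrDl.
move=> k w /=; apply: (malg_ext (f := fun v => lin_subst A (<< k *g w >> * v))
    (g := fun v => lin_subst A << k *g w >> * lin_subst A v)).
- by move=> u1 u2; rewrite mulrDr; exact: lin_substD.
- by move=> u1 u2; rewrite lin_substD; exact: mulrDr.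
move=> l w'; rewrite malgUM 3!lin_substU fmM big_cat /=.
by rewrite -scalerAl malg_mulrZ scalerA.
Qed.

Lemma lin_subst_gen A j : lin_subst A (gen3 R j) = \sum_i A i j *: gen3 R i.
Proof. by rewrite lin_substU fmU big_seq1 scale1r. Qed.

Lemma gen3_cube i : gen3 R i ^+ 3 = gen3 R i * gen3 R i * gen3 R i.
Proof. by rewrite exprSr expr2. Qed.

Lemma prod_gen3 (w : {fmonom 'I_3}) :
  \prod_(j <- (w : seq 'I_3)) gen3 R j = << w >>.
Proof.
case: w => s /=; elim: s => [|j s IHs]; first by rewrite big_nil -fmoneE.
rewrite big_cons IHs malgUM mulr1; congr << _ >>.
by apply/eqP; rewrite fmP fmM fmU.
Qed.

Lemma lin_subst_id u : lin_subst 1%:M u = u :> free3.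
Proof.
apply: (malg_ext (f := lin_subst 1%:M) (g := id)) => //; first exact: lin_substD.
move=> k w; rewrite lin_substU (eq_bigr (@gen3 R)).
  by rewrite prod_gen3 malgZU mulr1.
move=> j _; rewrite (bigD1 j) //= mxE eqxx scale1r big1 ?addr0 // => i ij.
by rewrite mxE (negbTE ij) scale0r.
Qed.

Lemma lin_subst_sum A (I : Type) (r : seq I) (G : I -> free3) :
  lin_subst A (\sum_(i <- r) G i) = \sum_(i <- r) lin_subst A (G i).
Proof. exact: (big_morph _ (lin_substD A) (lin_subst0 A)). Qed.

Lemma lin_subst_comp A B u : @lin_subst R (A *m B) u = lin_subst A (lin_subst B u).
Proof.
apply: (malg_ext (f := lin_subst _) (g := fun u => lin_subst A (lin_subst B u))).
- exact: lin_substD.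
- by move=> u1 u2; rewrite lin_substD; exact: lin_substD.
move=> k w; rewrite 2!lin_substU lin_substZ; congr (_ *: _).
rewrite (big_morph _ (lin_substM A) (lin_subst1 A)); apply: eq_bigr => j _.
rewrite lin_subst_sum.
transitivity (\sum_i \sum_l (A i l * B l j) *: gen3 R i).
  by apply: eq_bigr => i _; rewrite mxE scaler_suml.
rewrite exchange_big; apply: eq_bigr => i _ /=.
rewrite lin_substZ lin_subst_gen scaler_sumr; apply: eq_bigr => l _.
by rewrite scalerA mulrC.
Qed.

(** A monomial matrix, as for both generators of the Heisenberg group, permutes words up to scalars.
    Injectivity of [f] ensures that a single word contributes to each coefficient. *)
Lemma mcoeff_lin_subst_mono A (f : 'I_3 -> 'I_3) (d : 'I_3 -> C) :
  injective f -> (forall j, lin_subst A (gen3 R j) = d j *: gen3 R (f j)) ->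
  forall u (s : seq 'I_3), mcoeff (FMonom (map f s)) (lin_subst A u) =
    (\prod_(j <- s) d j) * mcoeff (FMonom s) u.
Proof.
move=> f_inj Af u s.
apply: (malg_ext (f := fun u => mcoeff _ (lin_subst A u))
                 (g := fun u => _ * mcoeff _ u)).
- by move=> u1 u2; rewrite lin_substD; exact: mcoeffD.
- by move=> u1 u2; rewrite mcoeffD; exact: mulrDr.
move=> k w; rewrite lin_substU.
have -> : \prod_(j <- (w : seq 'I_3)) (\sum_i A i j *: gen3 R i) =
    << \prod_(j <- (w : seq 'I_3)) d j *g FMonom (map f w) >>.
  case: w => t /=; elim: t => [|j t IHt]; first by rewrite 2!big_nil -fmoneE.
  rewrite 2!big_cons IHt -lin_subst_gen Af malgZU malgUM mulr1.
  by congr << _ *g _ >>; apply/eqP; rewrite fmP fmM fmU.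
rewrite malgZU 2!mcoeffU 2!fmP /= (inj_eq (inj_map f_inj)).
by case: eqP => [->|_]; rewrite ?mulr0n ?mulr0 // mulrC.
Qed.

End FreeAlgebra.

(** * Grading and order filtration of the free algebra *)

Section HomogeneousParts.
Variable K : comNzRingType.
Local Notation free3 := {malg K[{fmonom 'I_3}]}.

Definition hpart n : free3 -> free3 :=
  mmap (in_alg free3) (fun w : {fmonom 'I_3} => if fdeg w == n then << w >> else 0).

Lemma hpartD n : {morph hpart n : u v / u + v}.
Proof. exact: mmapD. Qed.

Lemma hpartB n : {morph hpart n : u v / u - v}.
Proof. exact: mmapB. Qed.

Lemma hpart0 n : hpart n 0 = 0.
Proof. exact: mmap0. Qed.

Lemma hpartU n k (w : {fmonom 'I_3}) :
  hpart n << k *g w >> = if fdeg w == n then << k *g w >> else 0.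
Proof.
rewrite [LHS]mmapU [LHS]mulr_algl; case: (fdeg w == n); last exact: scaler0.
by rewrite malgZU mulr1.
Qed.

Lemma mcoeff_hpart n u (w : {fmonom 'I_3}) :
  mcoeff w (hpart n u) = if fdeg w == n then mcoeff w u else 0.
Proof.
apply: (malg_ext (f := fun u => mcoeff w (hpart n u))
                 (g := fun u => if fdeg w == n then mcoeff w u else 0)).
- by move=> u1 u2; rewrite hpartD mcoeffD.
- by move=> u1 u2; case: (fdeg w == n); [exact: mcoeffD | rewrite addr0].
move=> k v; rewrite hpartU; have [<-|vw] := eqVneq v w.
  by case: (fdeg v == n); [| exact: mcoeff0].
have e : mcoeff w << k *g v >> = 0 by rewrite mcoeffU (negbTE vw).
by case: (fdeg v == n); case: (fdeg w == n); rewrite ?e ?mcoeff0.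
Qed.

(** Left multiplication by a word shifts degrees by its length; the guard keeps the truncated
    subtraction meaningful. *)
Lemma hpartUM n k (w : {fmonom 'I_3}) v : hpart n (<< k *g w >> * v) =
  if (fdeg w <= n)%N then << k *g w >> * hpart (n - fdeg w)%N v else 0.
Proof.
apply: (malg_ext (f := fun v => hpart n (<< k *g w >> * v)) (g := fun v =>
  if (fdeg w <= n)%N then << k *g w >> * hpart (n - fdeg w)%N v else 0)).
- by move=> v1 v2; rewrite mulrDr; exact: hpartD.
- move=> v1 v2; case: (fdeg w <= n)%N; last exact: esym (addr0 _).
  by rewrite hpartD; exact: mulrDr.
move=> l w' /=; rewrite malgUM 2!hpartU fdegM.
case: leqP => wn; last by rewrite gtn_eqF ?ltn_addr.
rewrite -(eqn_add2l (fdeg w) (fdeg w')) subnKC //.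
by case: (_ == n); [rewrite malgUM | exact: esym (mulr0 _)].
Qed.

Lemma hpartMU n k (w : {fmonom 'I_3}) v : hpart n (v * << k *g w >>) =
  if (fdeg w <= n)%N then hpart (n - fdeg w)%N v * << k *g w >> else 0.
Proof.
apply: (malg_ext (f := fun v => hpart n (v * << k *g w >>)) (g := fun v =>
  if (fdeg w <= n)%N then hpart (n - fdeg w)%N v * << k *g w >> else 0)).
- by move=> v1 v2; rewrite mulrDl; exact: hpartD.
- move=> v1 v2; case: (fdeg w <= n)%N; last exact: esym (addr0 _).
  by rewrite hpartD; exact: mulrDl.
move=> l w' /=; rewrite malgUM 2!hpartU fdegM addnC.
case: leqP => wn; last by rewrite gtn_eqF ?ltn_addr.
rewrite -(eqn_add2l (fdeg w) (fdeg w')) subnKC //.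
by case: (_ == n); [rewrite malgUM | exact: esym (mul0r _)].
Qed.

(** The n-th power of the augmentation ideal. *)
Definition ord_ge n (u : free3) :=
  forall w : {fmonom 'I_3}, mcoeff w u != 0 -> (n <= fdeg w)%N.

Lemma ord_ge0 u : ord_ge 0 u.
Proof. by []. Qed.

Lemma ord_geD n u v : ord_ge n u -> ord_ge n v -> ord_ge n (u + v).
Proof.
move=> nu nv w; rewrite mcoeffD; have [->|/nu //] := eqVneq (mcoeff w u) 0.
by rewrite add0r; exact: nv.
Qed.

Lemma ord_geZ n k u : ord_ge n u -> ord_ge n (k *: u).
Proof.
move=> nu w; rewrite mcoeffZ; have [->|/nu //] := eqVneq (mcoeff w u) 0.
by rewrite mulr0 eqxx.
Qed.

Lemma ord_geM m n u v : ord_ge m u -> ord_ge n v -> ord_ge (m + n) (u * v).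
Proof.
move=> mu nv w; rewrite mcoeff_neq0 => /msuppM_le [w1 [w2 [+ + ->]]].
rewrite -2!mcoeff_neq0 => /mu mw1 /nv nw2.
by rewrite fdegM leq_add.
Qed.

Lemma ord_ge_const u : ord_ge 1 (u - mcoeff (mone : {fmonom 'I_3}) u *: 1).
Proof.
move=> w; rewrite mcoeffB mcoeffZ mcoeff1 lt0n fdeg_eq0.
by have [->|//] := eqVneq w _; rewrite mulr1 subrr eqxx.
Qed.

Lemma hpart_ord_ge n m u : (m < n)%N -> ord_ge n u -> hpart m u = 0.
Proof.
move=> mn nu; apply/malgP => w; rewrite mcoeff_hpart mcoeff0.
have [wm|//] := eqVneq (fdeg w) m; apply: contraTeq mn => /nu.
by rewrite wm leqNgt.
Qed.

End HomogeneousParts.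

(** For u0, v0 the constant terms of u, v and f of degree 3, each of the two differences has order
    at least 4, so ufv is u0 v0 f up to higher order. *)
Lemma lalg_telescope (K : pzRingType) (A : lalgType K) (k u0 v0 : K) (u v f : A) :
  k *: (u * f * v) = (k * u0 * v0) *: f
    + (k *: ((u * f - u0 *: f) * v) + (k * u0) *: (f * v - v0 *: f)).
Proof.
rewrite mulrBl 2!scalerBr -scalerAl !scalerA [_ - _ + _]addrA subrK.
by rewrite addrCA subrr addr0.
Qed.

Section SklyaninIdeal.
Variable R : realType.
Local Notation C := R[i].
Local Notation free3 := (free_alg R).
Variables a b c : C.
Local Notation I := (skl_ideal a b c).
Local Notation pi := (skl_pi a b c).

Lemma homog3U n k (w : {fmonom 'I_3}) : fdeg w = n -> homog3 n (<< k *g w >> : free3).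
Proof.
move=> wn v; rewrite mcoeffU; have [<-|_] := eqVneq w v; first by [].
by rewrite mulr0n eqxx.
Qed.

Lemma homog3D n (u v : free3) : homog3 n u -> homog3 n v -> homog3 n (u + v).
Proof.
move=> nu nv w; rewrite mcoeffD; have [->|/nu //] := eqVneq (mcoeff w u) 0.
by rewrite add0r; exact: nv.
Qed.

Lemma homog3Z n k (u : free3) : homog3 n u -> homog3 n (k *: u).
Proof.
move=> nu w; rewrite mcoeffZ; have [->|/nu //] := eqVneq (mcoeff w u) 0.
by rewrite mulr0 eqxx.
Qed.

Lemma homog3M m n (u v : free3) :
  homog3 m u -> homog3 n v -> homog3 (m + n) (u * v).
Proof.
move=> mu nv w; rewrite mcoeff_neq0 => /msuppM_le [w1 [w2 [+ + ->]]].
by rewrite -2!mcoeff_neq0 => /mu <- /nv <-; exact: fdegM.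
Qed.

Lemma homog3_gen i : homog3 1 (gen3 R i).
Proof. by apply: homog3U; exact: fdegU. Qed.

Lemma hpart_homog3 n m (u : free3) :
  homog3 n u -> hpart m u = if m == n then u else 0.
Proof.
move=> nu; apply/malgP => w; rewrite mcoeff_hpart.
have [u0|/nu <-] := eqVneq (mcoeff w u) 0.
  by case: (m == n); rewrite u0 if_same ?mcoeff0.
by rewrite eq_sym; case: (_ == _); rewrite ?mcoeff0.
Qed.

Lemma skl_idealMl u v : v \in I -> u * v \in I.
Proof. by move=> Iv; rewrite -[u * v]mulr1; exact: skl_idealM. Qed.

Lemma skl_idealMr u v : u \in I -> u * v \in I.
Proof. by move=> Iu; rewrite -[u]mul1r; exact: skl_idealM. Qed.

Lemma skl_ideal0 : 0 \in I.
Proof. exact: rpred0. Qed.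

Lemma skl_idealD u v : u \in I -> v \in I -> u + v \in I.
Proof. exact: rpredD. Qed.

Lemma skl_idealB u v : u \in I -> v \in I -> u - v \in I.
Proof. exact: rpredB. Qed.

Lemma skl_ideal_rel u : skl_rel a b c u -> u \in I.
Proof. by move=> ru; apply/skl_idealP => J _; exact. Qed.

Lemma skl_rel_homog u : skl_rel a b c u -> homog3 2 u.
Proof.
have h2 i j k : homog3 2 (a *: (gen3 R i * gen3 R j)
    + b *: (gen3 R j * gen3 R i) + c *: gen3 R k ^+ 2).
  have hM i' j' : homog3 2 (gen3 R i' * gen3 R j').
    by apply: (@homog3M 1 1); exact: homog3_gen.
  by apply: homog3D; [apply: homog3D|]; apply: homog3Z; exact: hM.
by case=> ->; exact: h2.
Qed.

(** The ideal is graded because the relations are homogeneous. The induction treats all degrees at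
    once, since multiplication by a word shifts them. *)
Lemma hpart_skl_ideal n u : u \in I -> hpart n u \in I.
Proof.
move=> /skl_idealP/(_ (fun u => forall n, hpart n u \in I)); apply=> {n u}.
  split=> [n|u v Iu Iv n|u v w Iv].
  - by rewrite hpart0; exact: skl_ideal0.
  - by rewrite hpartB; exact: skl_idealB.
  have {Iv} Iuv : forall n, hpart n (u * v) \in I.
    elim/malg_ind: u => [n|u1 u2 I1 I2 n|k m n].
    - by rewrite mul0r hpart0; exact: skl_ideal0.
    - by rewrite mulrDl hpartD; exact: (skl_idealD (I1 n) (I2 n)).
    rewrite hpartUM; case: (fdeg m <= n)%N; last exact: skl_ideal0.
    exact/skl_idealMl/Iv.
  elim/malg_ind: w => [n|w1 w2 I1 I2 n|k m n].
  - by rewrite mulr0 hpart0; exact: skl_ideal0.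
  - by rewrite mulrDr hpartD; exact: (skl_idealD (I1 n) (I2 n)).
  rewrite hpartMU; case: (fdeg m <= n)%N; last exact: skl_ideal0.
  exact/skl_idealMr/Iuv.
move=> u ru n; rewrite (hpart_homog3 n (skl_rel_homog ru)).
by case: (n == 2)%N; [exact: skl_ideal_rel | exact: skl_ideal0].
Qed.

Lemma homog3_ord_ge n (u : free3) : homog3 n u -> ord_ge n u.
Proof. by move=> nu w /nu ->. Qed.

Lemma skl_piM u v : pi (u * v) = pi u * pi v.
Proof. exact: esym (skl_mulE a b c u v). Qed.

Lemma skl_piZ k u : pi (k *: u) = k *: pi u.
Proof. exact: esym (skl_scaleE a b c k u). Qed.

Lemma ord_ge_mul_const f u : ord_ge 3 f ->
  ord_ge 4 (u * f - mcoeff (mone : {fmonom 'I_3}) u *: f : free3).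
Proof.
move=> f3; have -> : u * f - mcoeff (mone : {fmonom 'I_3}) u *: f =
    (u - mcoeff (mone : {fmonom 'I_3}) u *: 1) * f.
  by rewrite mulrBl -scalerAl mul1r.
by apply: (@ord_geM _ 1 3); [exact: ord_ge_const | exact: f3].
Qed.

Lemma ord_ge_const_mul f u : ord_ge 3 f ->
  ord_ge 4 (f * u - mcoeff (mone : {fmonom 'I_3}) u *: f : free3).
Proof.
move=> f3; have -> : f * u - mcoeff (mone : {fmonom 'I_3}) u *: f =
    f * (u - mcoeff (mone : {fmonom 'I_3}) u *: 1).
  by rewrite mulrBr malg_mulrZ mulr1.
by apply: (@ord_geM _ 3 1); [exact: f3 | exact: ord_ge_const].
Qed.

(* Modulo elements of order at least 4, the ideal generated by an element of
   degree 3 is the line that it spans. *)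
Lemma skl_ideal_deg3 (f g : free3) : homog3 3 f -> homog3 3 g ->
  ideal_gen (eq (pi f)) (pi g) -> exists k, pi g = k *: pi f.
Proof.
move=> f3 g3 /(_ (fun t => exists k h, ord_ge 4 h /\ t = pi (k *: f + h))).
have f_ord := homog3_ord_ge f3.
case.
- split.
  + exists 0, 0; split; last by rewrite scale0r addr0 raddf0.
    by move=> w; rewrite mcoeff0 eqxx.
  + move=> _ _ [k [h [h4 ->]]] [k' [h' [h'4 ->]]]; exists (k - k'), (h - h').
    split; first by rewrite -scaleN1r; apply/ord_geD/ord_geZ.
    by rewrite -raddfB scalerBl opprD addrACA.
  move=> s _ t [k [h [h4 ->]]]; have [u ->] := skl_piW s; have [v ->] := skl_piW t.
  set u0 := mcoeff (mone : {fmonom 'I_3}) u.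
  set v0 := mcoeff (mone : {fmonom 'I_3}) v.
  exists (k * u0 * v0).
  exists (k *: ((u * f - u0 *: f) * v) + (k * u0) *: (f * v - v0 *: f)
    + u * h * v).
  split.
    apply: ord_geD; first apply: ord_geD.
    - apply: ord_geZ; apply: (@ord_geM _ 4 0); last exact: ord_ge0.
      exact: ord_ge_mul_const.
    - by apply: ord_geZ; exact: ord_ge_const_mul.
    apply: (@ord_geM _ 4 0); last exact: ord_ge0.
    by apply: (@ord_geM _ 0 4); first exact: ord_ge0.
  rewrite -(skl_piM u) -skl_piM; congr pi.
  rewrite mulrDr mulrDl addrA; congr (_ + _).
  by rewrite malg_mulrZ -scalerAl; exact: lalg_telescope.
- move=> _ <-; exists 1, 0; split; last by rewrite scale1r addr0.
  by move=> w; rewrite mcoeff0 eqxx.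
move=> k [h [h4 /skl_piE e]]; exists k.
rewrite -skl_piZ; apply/skl_piE.
(* In the degree 3 part of this element of the graded ideal, h disappears, being of order at least
   4. *)
have := hpart_skl_ideal 3 e; rewrite hpartB hpartD.
rewrite (hpart_homog3 3 g3) (hpart_homog3 3 (homog3Z (k := k) f3)).
by rewrite (hpart_ord_ge _ h4) // addr0.
Qed.

End SklyaninIdeal.

Lemma mul3Dl (A : pzRingType) (u1 u2 r v : A) :
  (u1 + u2) * r * v = u1 * r * v + u2 * r * v.
Proof. by rewrite !mulrDl. Qed.

Lemma mul3Dm (A : pzRingType) (u r1 r2 v : A) :
  u * (r1 + r2) * v = u * r1 * v + u * r2 * v.
Proof. by rewrite mulrDr mulrDl. Qed.

Lemma mul3A (A : pzRingType) (u1 u2 r v1 v2 : A) :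
  u1 * (u2 * r * v1) * v2 = (u1 * u2) * r * (v1 * v2).
Proof. by rewrite !mulrA. Qed.

(** * Linear forms on words of degree 3 that vanish on the relations *)

Section DegreeThreeFunctional.
Variable R : realType.
Local Notation C := R[i].
Local Notation free3 := (free_alg R).
Variables a b c : C.
Variable l : 'rV[C]_3.

(* Additions of indices are modulo 3, in accordance with the cyclic symmetry
   of the relations. *)
Definition word_weight (w : seq 'I_3) : C :=
  if w is [:: i; j; k] then
    if (j == i + 1) && (k == i + 2) then l 0 0
    else if (j == i + 2) && (k == i + 1) then l 0 1
    else if (j == i) && (k == i) then l 0 2 else 0
  else 0.

Definition weight_form : free3 -> C :=
  mmap idfun (fun w : {fmonom 'I_3} => word_weight w).

Lemma weight_formD : {morph weight_form : u v / u + v}.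
Proof. exact: mmapD. Qed.

Lemma weight_formD0 u v :
  weight_form u = 0 -> weight_form v = 0 -> weight_form (u + v) = 0.
Proof. by rewrite weight_formD => -> ->; exact: addr0. Qed.

Lemma weight_form0 : weight_form 0 = 0.
Proof. exact: mmap0. Qed.

Lemma weight_formU k (w : {fmonom 'I_3}) :
  weight_form << k *g w >> = k * word_weight w.
Proof. exact: (mmapU (f := idfun)). Qed.

Lemma weight_formZ k u : weight_form (k *: u) = k * weight_form u.
Proof.
apply: (malg_ext (f := fun u => weight_form (k *: u))
                 (g := fun u => k * weight_form u)).
- by move=> u1 u2; rewrite scalerDr; exact: weight_formD.
- by move=> u1 u2; rewrite weight_formD; exact: mulrDr.
move=> k' w; transitivity (weight_form << k * k' *g w >>).
  by congr weight_form; exact: malgZU.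
rewrite [LHS]weight_formU -mulrA; congr (_ * _).
exact: esym (weight_formU _ _).
Qed.

Lemma weight_form_gen i j k :
  weight_form (gen3 R i * gen3 R j * gen3 R k) = word_weight [:: i; j; k].
Proof.
by rewrite malgUM malgUM weight_formU !mulr1 mul1r !(fmM, fmU).
Qed.

Lemma weight_form_mono k k' (v w : {fmonom 'I_3}) i j :
  weight_form (<< k *g v >> * (gen3 R i * gen3 R j) * << k' *g w >>) =
  k * k' * word_weight (v ++ [:: i; j] ++ w).
Proof.
rewrite (malgUM 1 1) malgUM malgUM weight_formU !mulr1 !(fmM, fmU).
by rewrite -catA.
Qed.

(** Only words of length 3 have weight, so a single letter accompanies the relation. If it is x_i,
    the three weights are the coordinates of [l] in order; otherwise all of them are 0. *)
Lemma word_weight_rel (i : 'I_3) (v w : seq 'I_3) :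
  a * l 0 0 + b * l 0 1 + c * l 0 2 = 0 ->
  a * word_weight (v ++ [:: i + 1; i + 2] ++ w)
  + b * word_weight (v ++ [:: i + 2; i + 1] ++ w)
  + c * word_weight (v ++ [:: i; i] ++ w) = 0.
Proof.
move=> abcl; have zero : a * 0 + b * 0 + c * 0 = 0 by rewrite !mulr0 !addr0.
case: v => [|j [|k [|k' [|? v]]]]; case: w => [|j' [|k'' w]]; try exact: zero.
- by case: (ord3P i) (ord3P j') => -> [] ->; rewrite ?zero ?abcl.
- by case: (ord3P i) (ord3P j) => -> [] ->; rewrite ?zero ?abcl.
Qed.

Lemma weight_form3D u r1 r2 v : weight_form (u * (r1 + r2) * v) =
  weight_form (u * r1 * v) + weight_form (u * r2 * v).
Proof.
exact: etrans (congr1 weight_form (mul3Dm u r1 r2 v)) (weight_formD _ _).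
Qed.

Lemma weight_form3Z u k r v :
  weight_form (u * (k *: r) * v) = k * weight_form (u * r * v).
Proof. by rewrite malg_mulrZ -scalerAl; exact: weight_formZ. Qed.

Lemma weight_form_rel r : a * l 0 0 + b * l 0 1 + c * l 0 2 = 0 ->
  skl_rel a b c r -> forall u v, weight_form (u * r * v) = 0.
Proof.
have relE i j k : j = i + 1 -> k = i + 2 ->
    a *: (gen3 R j * gen3 R k) + b *: (gen3 R k * gen3 R j) + c *: gen3 R i ^+ 2 =
    a *: (gen3 R (i + 1) * gen3 R (i + 2)) + b *: (gen3 R (i + 2) * gen3 R (i + 1))
    + c *: (gen3 R i * gen3 R i) by move=> -> ->; rewrite expr2.
move=> abcl rel_r; have [i rE] : exists i : 'I_3, r =
    a *: (gen3 R (i + 1) * gen3 R (i + 2)) + b *: (gen3 R (i + 2) * gen3 R (i + 1))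
    + c *: (gen3 R i * gen3 R i).
  by case: rel_r => ->; [exists 0|exists 1|exists 2]; apply: relE;
    apply: val_inj.
elim/malg_ind=> [|u1 u2 e1 e2|k m] v.
- by rewrite 2!mul0r; exact: weight_form0.
- by rewrite mul3Dl; exact: weight_formD0 (e1 v) (e2 v).
elim/malg_ind: v => [|v1 v2 e1 e2|k' m'].
- by rewrite mulr0; exact: weight_form0.
- by rewrite mulrDr; exact: weight_formD0 e1 e2.
have relD X Y : weight_form (X * r * Y) =
    a * weight_form (X * (gen3 R (i + 1) * gen3 R (i + 2)) * Y)
    + b * weight_form (X * (gen3 R (i + 2) * gen3 R (i + 1)) * Y)
    + c * weight_form (X * (gen3 R i * gen3 R i) * Y).
  rewrite rE; apply: etrans (weight_form3D _ _ _ _) _.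
  congr (_ + _); last exact: weight_form3Z.
  by apply: etrans (weight_form3D _ _ _ _) _; congr (_ + _); exact: weight_form3Z.
rewrite relD; transitivity (k * k'
    * (a * word_weight (m ++ [:: i + 1; i + 2] ++ m')
       + b * word_weight (m ++ [:: i + 2; i + 1] ++ m')
       + c * word_weight (m ++ [:: i; i] ++ m'))).
  rewrite 2!mulrDr 3![k * k' * (_ * _)]mulrCA.
  by congr (_ * _ + _ * _ + _ * _); exact: weight_form_mono.
by rewrite word_weight_rel // mulr0.
Qed.

Lemma weight_form_ideal u : a * l 0 0 + b * l 0 1 + c * l 0 2 = 0 ->
  u \in skl_ideal a b c -> weight_form u = 0.
Proof.
(* The kernel of the form is not an ideal; the elements all of whose two-sided multiples lie in it
   do form one. *)
move=> abcl /skl_idealP/(_ (fun u => forall v w, weight_form (v * u * w) = 0)).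
suff H : (forall v w, weight_form (v * u * w) = 0) -> weight_form u = 0.
  move=> J; apply/H/J => [|r rel_r]; last exact: weight_form_rel.
  split=> [v w|u1 u2 e1 e2 v w|u1 u2 u3 e v w].
  - by rewrite mulr0 mul0r; exact: weight_form0.
  - have Ne2 : weight_form (v * - u2 * w) = 0.
      rewrite -scaleN1r; apply: etrans (weight_form3Z _ _ _ _) _.
      exact: etrans (congr1 _ (e2 v w)) (mulr0 _).
    apply: etrans (weight_form3D _ _ _ _) _.
    exact: etrans (congr2 +%R (e1 v w) Ne2) (addr0 0).
  by rewrite mul3A; exact: e.
by move=> /(_ 1 1); rewrite mul1r mulr1.
Qed.

(** The factor 3 counts the words in each of f1, f2 and f3. *)
Lemma weight_form_invariant al be ga :
  weight_form (al *: f1 R + be *: f2 R + ga *: f3 R) =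
  (al * l 0 0 + be * l 0 1 + ga * l 0 2) *+ 3.
Proof.
have sum3 u v w :
    weight_form (u + v + w) = weight_form u + weight_form v + weight_form w.
  by apply: etrans (weight_formD _ _) _; congr (_ + _); exact: weight_formD.
have three i j k i' j' k' i2 j2 k2 t : word_weight [:: i; j; k] = t ->
    word_weight [:: i'; j'; k'] = t -> word_weight [:: i2; j2; k2] = t ->
    weight_form (gen3 R i * gen3 R j * gen3 R k + gen3 R i' * gen3 R j' * gen3 R k'
      + gen3 R i2 * gen3 R j2 * gen3 R k2) = t *+ 3.
  move=> e1 e2 e3; apply: etrans (sum3 _ _ _) _; rewrite mulrSr mulr2n.
  congr (_ + _ + _); [rewrite -e1 | rewrite -e2 | rewrite -e3];
  exact: weight_form_gen.
apply: etrans (sum3 _ _ _) _; rewrite 2!mulrnDl -3!mulrnAr; congr (_ + _ + _).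
- by apply: etrans (weight_formZ _ _) _; congr (_ * _); exact: three.
- by apply: etrans (weight_formZ _ _) _; congr (_ * _); exact: three.
apply: etrans (weight_formZ _ _) _; congr (_ * _).
by rewrite /f3 (gen3_cube R 0) (gen3_cube R 1) (gen3_cube R 2); exact: three.
Qed.

End DegreeThreeFunctional.

(** * Point modules *)

Section PointModules.
Variable R : realType.
Local Notation C := R[i].
Variables a b c : C.
Local Notation S := (sklyanin a b c).
Local Notation pi := (skl_pi a b c).
Variable M : lmodType S^c.
Local Notation ract := Defs.ract.

Lemma ractD (v : M) (s t : S) : ract v (s + t) = ract v s + ract v t.
Proof. exact: scalerDl. Qed.

Lemma ractM (v : M) (s t : S) : ract v (s * t) = ract (ract v s) t.
Proof. exact: esym (scalerA (t : S^c) (s : S^c) v). Qed.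

Lemma ract0 (v : M) : ract v (0 : S) = 0.
Proof. exact: scale0r. Qed.

Lemma skl_algC k (s : S) : k%:A * s = s * k%:A.
Proof.
have [f ->] := skl_piW s; rewrite mulr_algl.
rewrite -[1 in RHS]/(pi 1).
rewrite -[RHS](etrans (skl_piM _ _ _ f (k *: 1)) (congr1 _ (skl_piZ _ _ _ k 1))).
by rewrite malg_mulrZ mulr1; exact: esym (skl_piZ _ _ _ k f).
Qed.

Lemma ractZ (v : M) k (s : S) : ract v (k *: s) = cscale k (ract v s).
Proof. by rewrite -mulr_algl skl_algC ractM. Qed.

Lemma cscale_ract (v : M) k (s : S) : ract (cscale k v) s = cscale k (ract v s).
Proof. by rewrite /cscale -2!ractM skl_algC. Qed.

Lemma cscaleA k l (v : M) : cscale k (cscale l v) = cscale (k * l) v.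
Proof. by rewrite /cscale -ractM mulr_algl scalerA mulrC. Qed.

Lemma cscaleDl k l (v : M) : cscale (k + l) v = cscale k v + cscale l v.
Proof. by rewrite /cscale scalerDl ractD. Qed.

Lemma cscale0r (v : M) : cscale 0 v = 0.
Proof. by rewrite /cscale scale0r ract0. Qed.

Lemma cscaler0 k : cscale k (0 : M) = 0.
Proof. exact: scaler0. Qed.

Section Basis.
Variables (m : nat -> M) (pt : nat -> 'rV[C]_3).
Hypothesis m_basis :
  forall v, exists! q : {poly C}, v = \sum_(i < size q) cscale q`_i (m i).
Hypothesis m_act :
  forall i j, ract (m i) (pi (gen3 R j)) = cscale (pt i 0 j) (m i.+1).

(** With k nonzero, the vector 0 would have two coefficient polynomials, 0 and [k *: 'X^n]. *)
Lemma cscale_basis_eq0 k n : cscale k (m n) = 0 -> k = 0.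
Proof.
move=> kn0; have [q [_ q_uniq]] := m_basis 0.
have q0 : q = 0 by apply: q_uniq; rewrite size_poly0 big_ord0.
apply/eqP; apply: contraT => k0.
have qk : q = k *: 'X^n.
  apply: q_uniq; rewrite size_scale // size_polyXn big_ord_recr /= big1.
    by rewrite add0r coefZ coefXn eqxx mulr1 kn0.
  by move=> i _; rewrite coefZ coefXn ltn_eqF ?ltn_ord // mulr0 cscale0r.
have := congr1 (fun p : {poly C} => p`_n) (etrans (esym q0) qk).
by rewrite coef0 coefZ coefXn eqxx mulr1 => /esym/eqP; rewrite (negbTE k0).
Qed.

Lemma ract_gen2 i j k : ract (m i) (pi (gen3 R j * gen3 R k)) =
  cscale (pt i 0 j * pt i.+1 0 k) (m i.+2).
Proof. by rewrite skl_piM ractM m_act cscale_ract m_act cscaleA. Qed.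

Lemma ract_gen3 i j k l : ract (m i) (pi (gen3 R j * gen3 R k * gen3 R l)) =
  cscale (pt i 0 j * pt i.+1 0 k * pt i.+2 0 l) (m i.+3).
Proof. by rewrite skl_piM ractM ract_gen2 cscale_ract m_act cscaleA. Qed.

Lemma ract_lin3 (v : M) k1 k2 k3 u1 u2 u3 :
  ract v (pi (k1 *: u1 + k2 *: u2 + k3 *: u3)) =
  cscale k1 (ract v (pi u1)) + cscale k2 (ract v (pi u2))
  + cscale k3 (ract v (pi u3)).
Proof.
have actD u w : ract v (pi (u + w)) = ract v (pi u) + ract v (pi w).
  by rewrite skl_piD ractD.
have actZ k u : ract v (pi (k *: u)) = cscale k (ract v (pi u)).
  by rewrite skl_piZ ractZ.
have act12 := etrans (actD (k1 *: u1) (k2 *: u2))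
  (congr2 +%R (actZ k1 u1) (actZ k2 u2)).
exact: etrans (actD _ (k3 *: u3)) (congr2 +%R act12 (actZ k3 u3)).
Qed.

(** A relation acts on m_i as the value of its bilinear form times the basis vector m_(i+2), and it
    acts as 0. *)
Lemma point_bilin_rel i : bilin_rel a b c (pt i) (pt i.+1).
Proof.
have rel0 u : skl_rel a b c u -> ract (m i) (pi u) = 0.
  move=> ru; suff -> : pi u = 0 by exact: ract0.
  have <- : pi 0 = 0 by exact: raddf0.
  by apply/skl_piE; rewrite subr0; exact: skl_ideal_rel.
have act2 j1 k1 j2 k2 j3 k3 : ract (m i) (pi (a *: (gen3 R j1 * gen3 R k1)
      + b *: (gen3 R j2 * gen3 R k2) + c *: (gen3 R j3 * gen3 R k3))) =
    cscale (a * (pt i 0 j1 * pt i.+1 0 k1) + b * (pt i 0 j2 * pt i.+1 0 k2)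
      + c * (pt i 0 j3 * pt i.+1 0 k3)) (m i.+2).
  rewrite [LHS]ract_lin3 2!cscaleDl; congr (_ + _ + _);
  by apply: etrans _ (cscaleA _ _ _); congr cscale; exact: ract_gen2.
split; apply: (@cscale_basis_eq0 _ i.+2); rewrite -act2; apply: rel0.
- exact: Or31.
- exact: Or32.
exact: Or33.
Qed.

Lemma ract_invariant al be ga i :
  ract (m i) (pi (al *: f1 R + be *: f2 R + ga *: f3 R)) =
  cscale (c3_form al be ga (pt i) (pt i.+1) (pt i.+2)) (m i.+3).
Proof.
have sum3 j1 k1 l1 j2 k2 l2 j3 k3 l3 :
    ract (m i) (pi (gen3 R j1 * gen3 R k1 * gen3 R l1
      + gen3 R j2 * gen3 R k2 * gen3 R l2 + gen3 R j3 * gen3 R k3 * gen3 R l3)) =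
    cscale (pt i 0 j1 * pt i.+1 0 k1 * pt i.+2 0 l1
      + pt i 0 j2 * pt i.+1 0 k2 * pt i.+2 0 l2
      + pt i 0 j3 * pt i.+1 0 k3 * pt i.+2 0 l3) (m i.+3).
  have actD u w : ract (m i) (pi (u + w)) =
      ract (m i) (pi u) + ract (m i) (pi w) by rewrite skl_piD ractD.
  have act12 := etrans (actD (gen3 R j1 * gen3 R k1 * gen3 R l1)
    (gen3 R j2 * gen3 R k2 * gen3 R l2))
    (congr2 +%R (ract_gen3 _ _ _ _) (ract_gen3 _ _ _ _)).
  rewrite 2!cscaleDl.
  exact: etrans (actD _ _) (congr2 +%R act12 (ract_gen3 _ j3 k3 l3)).
apply: etrans (ract_lin3 _ _ _ _ _ _ _) _; rewrite /c3_form 2!cscaleDl.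
congr (_ + _ + _); apply: etrans _ (cscaleA _ _ _); congr cscale.
- exact: sum3.
- exact: sum3.
by rewrite /f3 (gen3_cube R 0) (gen3_cube R 1) (gen3_cube R 2); exact: sum3.
Qed.

Lemma annihilates_basis s : (forall i, ract (m i) s = 0) -> annihilates M s.
Proof.
move=> ms v; have [q [-> _]] := m_basis v.
rewrite /ract scaler_sumr big1 // => i _.
by rewrite -[_ *: _]/(ract _ s) cscale_ract ms cscaler0.
Qed.

End Basis.

Lemma opp2_annihilates_point_module (p : 'rV[C]_3) :
  smooth_curve (skl_curve a b c) -> is_point_module M p ->
  annihilates M (pi ((a * (b ^+ 3 - c ^+ 3)) *: f1 R
    + (b * (c ^+ 3 - a ^+ 3)) *: f2 R + (c * (a ^+ 3 - b ^+ 3)) *: f3 R)).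
Proof.
move=> sm [m [pt [m_basis _ pt_add m_act]]].
apply: (annihilates_basis m_basis) => i; rewrite (ract_invariant m_act).
rewrite c3_form_point ?cscale0r //; last first.
- exact: point_bilin_rel m_basis m_act _.
- exact: point_bilin_rel m_basis m_act _.
(* The middle point [pt i.+1] is on the cubic, being the result of an addition. *)
by have [N [_ [_ _ cN _]]] := pt_add i.
Qed.

End PointModules.

(** * Invariants of the Heisenberg group *)

Section Invariants.
Variable R : realType.
Local Notation C := R[i].
Local Notation free3 := (free_alg R).
Local Notation inv al be ga := (al *: f1 R + be *: f2 R + ga *: f3 R).

Lemma mcoeff_gens i j k s :
  mcoeff (FMonom s) (gen3 R i * gen3 R j * gen3 R k) = ([:: i; j; k] == s)%:R.
Proof. by rewrite malgUM malgUM 2!mulr1 mcoeffU fmP !(fmM, fmU). Qed.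

(** The function that defines the linear forms also lists the coefficients of the invariants, so
    invariance can be checked word by word. *)
Lemma mcoeff_invariant al be ga s :
  mcoeff (FMonom s) (inv al be ga) = word_weight (vec3 al be ga) s.
Proof.
have mcoeff3 i1 j1 k1 i2 j2 k2 i3 j3 k3 :
    mcoeff (FMonom s) (gen3 R i1 * gen3 R j1 * gen3 R k1
      + gen3 R i2 * gen3 R j2 * gen3 R k2 + gen3 R i3 * gen3 R j3 * gen3 R k3) =
    ([:: i1; j1; k1] == s)%:R + ([:: i2; j2; k2] == s)%:R
    + ([:: i3; j3; k3] == s)%:R.
  apply: etrans (mcoeffD _ _ _) _; congr (_ + _); last exact: mcoeff_gens.
  by apply: etrans (mcoeffD _ _ _) _; congr (_ + _); exact: mcoeff_gens.
have f1E : mcoeff (FMonom s) (f1 R) =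
    ([:: 2; 0; 1] == s)%:R + ([:: 0; 1; 2] == s)%:R + ([:: 1; 2; 0] == s)%:R.
  exact: mcoeff3.
have f2E : mcoeff (FMonom s) (f2 R) =
    ([:: 1; 0; 2] == s)%:R + ([:: 2; 1; 0] == s)%:R + ([:: 0; 2; 1] == s)%:R.
  exact: mcoeff3.
have f3E : mcoeff (FMonom s) (f3 R) =
    ([:: 0; 0; 0] == s)%:R + ([:: 1; 1; 1] == s)%:R + ([:: 2; 2; 2] == s)%:R.
  by rewrite /f3 (gen3_cube R 0) (gen3_cube R 1) (gen3_cube R 2); exact: mcoeff3.
have mcoeffDZ (u v : free3) (k t1 t2 : C) : mcoeff (FMonom s) u = t1 ->
    mcoeff (FMonom s) v = t2 -> mcoeff (FMonom s) (u + k *: v) = t1 + k * t2.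
  by move=> <- <-; rewrite mcoeffD mcoeffZ.
have inv1 : mcoeff (FMonom s) (al *: f1 R) = al * mcoeff (FMonom s) (f1 R).
  exact: mcoeffZ.
rewrite f1E in inv1; have inv2 := mcoeffDZ _ _ be _ _ inv1 f2E.
rewrite (mcoeffDZ _ _ ga _ _ inv2 f3E) {inv1 inv2 mcoeffDZ}.
case: s {mcoeff3 f1E f2E f3E} => [|i [|j [|k [|l s]]]];
  rewrite ?(eqseq_cons, andbF, addr0, mulr0) //.
rewrite /word_weight !vec3E.
by case: (ord3P i) (ord3P j) (ord3P k) => -> [] -> [] ->;
  rewrite -!val_eqE /= ?(addr0, add0r, mulr0, mulr1).
Qed.

Lemma lin_subst_mono_fix A (f g : 'I_3 -> 'I_3) (d : 'I_3 -> C) (u : free3) :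
  cancel f g -> cancel g f ->
  (forall j, lin_subst A (gen3 R j) = d j *: gen3 R (f j)) ->
  lin_subst A u = u <-> (forall s : seq 'I_3,
    mcoeff (FMonom (map f s)) u = (\prod_(j <- s) d j) * mcoeff (FMonom s) u).
Proof.
move=> fK gK Af; have mono := mcoeff_lin_subst_mono (can_inj fK) Af u.
split=> [uA s|us]; first by rewrite -mono uA.
apply/malgP => w; rewrite -[w]fmK; case: w => s /=.
by rewrite -[s](mapK gK) mono us.
Qed.

Lemma homog3_invariant al be ga : homog3 3 (inv al be ga).
Proof.
move=> m; rewrite -[m]fmK mcoeff_invariant fdegE; case: m => s /=.
by case: s => [|i [|j [|k [|? ?]]]]; rewrite ?eqxx.
Qed.

Variables (A1 A2 : 'M[C]_3) (w : C).
Hypothesis w_prim : 3.-primitive_root w.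
Hypothesis A1_gen : forall j, lin_subst A1 (gen3 R j) = 1 *: gen3 R (j + 2).
Hypothesis A2_gen : forall j : 'I_3, lin_subst A2 (gen3 R j) = w ^+ j *: gen3 R j.

Let addr12K : cancel (fun j : 'I_3 => j + 2) (fun j => j + 1).
Proof. by move=> j; case: (ord3P j) => ->; apply: val_inj. Qed.

Let addr21K : cancel (fun j : 'I_3 => j + 1) (fun j => j + 2).
Proof. by move=> j; case: (ord3P j) => ->; apply: val_inj. Qed.

Let fix2P u := @lin_subst_mono_fix A2 id id (fun j : 'I_3 => w ^+ j) u
  (fun=> erefl) (fun=> erefl) A2_gen.

(** On a word, e2 acts by w to the sum of its indices; this sum is 0 modulo 3 wherever the weight is
    nonzero. *)
Lemma word_weight_mod (l : 'rV[C]_3) (i j k : 'I_3) :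
  word_weight l [:: i; j; k] = 0 \/ (3 %| i + j + k)%N.
Proof.
by case: (ord3P i) (ord3P j) (ord3P k) => -> [] -> [] ->; (left; done) || right.
Qed.

Lemma invariant_fix1 al be ga : lin_subst A1 (inv al be ga) = inv al be ga.
Proof.
apply/(lin_subst_mono_fix _ addr12K addr21K A1_gen) => s.
rewrite 2!mcoeff_invariant big1 // mul1r.
case: s => [|i [|j [|k [|//]]]] //=.
by case: (ord3P i) (ord3P j) (ord3P k) => -> [] -> [] ->.
Qed.

Lemma invariant_fix2 al be ga : lin_subst A2 (inv al be ga) = inv al be ga.
Proof.
apply/(fix2P _) => s; rewrite map_id mcoeff_invariant.
case: s => [|i [|j [|k [|? ?]]]]; rewrite ?mulr0 //.
case: (word_weight_mod (vec3 al be ga) i j k) => [->|]; first by rewrite mulr0.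
rewrite !big_cons big_nil mulr1 -!exprD addnA (prim_order_dvd w_prim) => /eqP ->.
by rewrite mul1r.
Qed.

(** Invariance under e1 reduces every coefficient to a word starting with x. Invariance under e2
    kills those whose index sum is not 0 modulo 3, which leaves xyz, xzy and xxx. *)
Lemma fixed_invariant f : homog3 3 f -> lin_subst A1 f = f -> lin_subst A2 f = f ->
  exists al be ga, f = inv al be ga.
Proof.
move=> f3 /(lin_subst_mono_fix _ addr12K addr21K A1_gen) fix1.
move=> /fix2P fix2.
pose cf s : C := mcoeff (FMonom s) f.
have shift i j k : cf [:: i; j; k] = cf [:: 0; j - i; k - i].
  have shift2 i' j' k' : cf [:: i' + 2; j' + 2; k' + 2] = cf [:: i'; j'; k'].
    by have := fix1 [:: i'; j'; k']; rewrite big1 // mul1r.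
  case: (ord3P i) => ->; first by rewrite 2!subr0.
    by rewrite -shift2; congr cf; congr [:: _; _; _]; apply: val_inj.
  rewrite -(shift2 0); congr cf; congr [:: _; _; _]; rewrite ?subrK //.
  exact: val_inj.
have zero (m n : 'I_3) : ~~ (3 %| m + n)%N -> cf [:: 0; m; n] = 0.
  have := fix2 [:: 0; m; n].
  rewrite map_id !big_cons big_nil mulr1 expr0 mul1r -exprD (prim_order_dvd w_prim).
  move/eqP; rewrite -subr_eq0 -{1}[mcoeff _ _]mul1r -mulrBl mulf_eq0 subr_eq0.
  by rewrite [1 == _]eq_sym => /orP[->//|/eqP].
exists (cf [:: 0; 1; 2]), (cf [:: 0; 2; 1]), (cf [:: 0; 0; 0]).
apply/malgP => m; rewrite -[m]fmK mcoeff_invariant; case: m => s /=.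
have [s3|s3] := eqVneq (size s) 3; last first.
  have -> : mcoeff (FMonom s) f = 0.
    by apply/eqP; apply: contraNT s3 => /f3/eqP.
  by case: s s3 => [|i [|j [|k [|? ?]]]].
case: s s3 => [|i [|j [|k [|//]]]] // _.
rewrite -[LHS]/(cf _) shift /word_weight !vec3E.
have eqD (t u : 'I_3) : (t == i + u) = (t - i == u) by rewrite subr_eq addrC.
rewrite !eqD -(subr_eq0 j) -(subr_eq0 k).
move: (j - i) (k - i) => m n {eqD}.
by case: (ord3P m) (ord3P n) => -> [] -> //=; exact: zero.
Qed.

End Invariants.

(** * The Heisenberg group acts on the quotient *)

Section HeisenbergAction.
Variable R : realType.
Local Notation C := R[i].
Local Notation free3 := (free_alg R).
Variables (gT : finGroupType) (H : {group gT}) (e1 e2 : gT).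
Hypothesis H3 : is_H3 H e1 e2.

(** In a finite group the elements of a generated subgroup are products of generators, so closure
    under inverses is automatic. *)
Lemma H3_ind (P : gT -> Prop) : P 1%g ->
  (forall g h, g \in H -> h \in H -> P g -> P h -> P (g * h)%g) ->
  P e1 -> P e2 -> forall g, g \in H -> P g.
Proof.
case: H3 => HE _ _ _ P1 PM Pe1 Pe2 g.
have sub_gen h : h \in [set e1; e2] -> h \in H by rewrite HE; exact: mem_gen.
rewrite {1}HE => /gen_prodgP [n [h hP ->]].
suff [] : (\prod_(i < n) h i)%g \in H /\ P (\prod_(i < n) h i)%g by [].
apply: (big_ind (fun x => x \in H /\ P x)) => [|x y [Hx Px] [Hy Py]|i _].
- by split.
- by split; [exact: groupM | exact: PM].
by split; [exact: sub_gen | case/set2P: (hP i) => ->].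
Qed.

Variable rV : mx_representation C H 3.

Lemma lin_subst_H3_fix (f : free3) :
  lin_subst (rV e1) f = f -> lin_subst (rV e2) f = f ->
  forall g, g \in H -> lin_subst (rV g) f = f.
Proof.
move=> f_e1 f_e2.
apply: (H3_ind (P := fun g => lin_subst (rV g) f = f) _ _ f_e1 f_e2).
  by rewrite repr_mx1; exact: lin_subst_id.
move=> g h Hg Hh fg fh; rewrite (repr_mxM rV Hg Hh) lin_subst_comp.
exact: etrans (congr1 (lin_subst (rV g)) fh) fg.
Qed.

Variables (a b c w : C).
Hypothesis w_prim : 3.-primitive_root w.
Hypothesis rV_V1 : is_V1 rV e1 e2 w.

Lemma V1_gen1 j : lin_subst (rV e1) (gen3 R j) = 1 *: gen3 R (j + 2).
Proof.
case: rV_V1 => [[e1x e1y e1z] _]; rewrite scale1r.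
by case: (ord3P j) => ->; rewrite ?e1x ?e1y ?e1z; congr gen3; apply: val_inj.
Qed.

Lemma V1_gen2 (j : 'I_3) : lin_subst (rV e2) (gen3 R j) = w ^+ j *: gen3 R j.
Proof.
case: rV_V1 => [_ [e2x e2y e2z]].
case: (ord3P j) => ->; [|exact: e2y|exact: e2z].
exact: etrans e2x (esym (scale1r _)).
Qed.

Lemma malg_scaleM k l (u v : free3) : (k *: u) * (l *: v) = (k * l) *: (u * v).
Proof. by rewrite -scalerAl malg_mulrZ scalerA. Qed.

Lemma lin_subst_scaled A m (u v t : free3) : lin_subst A u = m *: u ->
  lin_subst A v = m *: v -> lin_subst A t = m *: t ->
  lin_subst A (a *: u + b *: v + c *: t) = m *: (a *: u + b *: v + c *: t).
Proof.
move=> Au Av At.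
have scaled k s : lin_subst A s = m *: s -> lin_subst A (k *: s) = m *: (k *: s).
  have swap (V : lmodType C) l1 l2 (x : V) : l1 *: (l2 *: x) = l2 *: (l1 *: x).
    by rewrite 2!scalerA mulrC.
  by move=> As; apply: etrans (lin_substZ A k s) _; rewrite As; exact: swap.
have sum s1 s2 : lin_subst A s1 = m *: s1 -> lin_subst A s2 = m *: s2 ->
    lin_subst A (s1 + s2) = m *: (s1 + s2).
  move=> As1 As2; apply: etrans (lin_substD A s1 s2) _.
  by rewrite As1 As2; exact: esym (scalerDr m s1 s2).
exact: sum (sum _ _ (scaled a u Au) (scaled b v Av)) (scaled c t At).
Qed.

(** The generator e1 permutes the relations cyclically. The generator e2 scales each one, because
    its words x_i x_j, x_j x_i and x_k^2 satisfy i + j = 2k modulo 3. *)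
Lemma lin_subst_H3_ideal g : g \in H -> forall u,
  u \in skl_ideal a b c -> lin_subst (rV g) u \in skl_ideal a b c.
Proof.
have from_rel A : (forall r, skl_rel a b c r -> lin_subst A r \in skl_ideal a b c) ->
    forall u, u \in skl_ideal a b c -> lin_subst A u \in skl_ideal a b c.
  move=> Arel u /skl_idealP/(_ (fun u => lin_subst A u \in skl_ideal a b c)).
  apply; last exact: Arel.
  split=> [|u1 u2 I1 I2|u1 u2 u3 I2].
  - by rewrite lin_subst0; exact: skl_ideal0.
  - rewrite lin_substD -scaleN1r lin_substZ scaleN1r; exact: skl_idealB I1 I2.
  by rewrite lin_substM lin_substM; exact: skl_idealM.
have rel2 i j k A : lin_subst A (a *: (gen3 R i * gen3 R j)
      + b *: (gen3 R j * gen3 R i) + c *: gen3 R k ^+ 2) =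
    a *: (lin_subst A (gen3 R i) * lin_subst A (gen3 R j))
    + b *: (lin_subst A (gen3 R j) * lin_subst A (gen3 R i))
    + c *: lin_subst A (gen3 R k) ^+ 2.
  have linD u v : lin_subst A (u + v) = lin_subst A u + lin_subst A v.
    exact: lin_substD.
  have linZM d u v : lin_subst A (d *: (u * v)) =
      d *: (lin_subst A u * lin_subst A v) by rewrite lin_substZ lin_substM.
  apply: etrans (linD _ _) _; congr (_ + _); last exact: linZM.
  by apply: etrans (linD _ _) _; congr (_ + _); exact: linZM.
case: rV_V1 => [[e1x e1y e1z] [e2x e2y e2z]].
have w3 : w ^+ 3 = 1 by exact: prim_expr_order.
apply: (H3_ind (P := fun g => forall u, u \in skl_ideal a b c ->
  lin_subst (rV g) u \in skl_ideal a b c)) => [u|g' h Hg Hh Ig Ih u Iu||].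
- by rewrite repr_mx1 lin_subst_id.
- by rewrite (repr_mxM rV Hg Hh) lin_subst_comp; exact/Ig/Ih.
- apply: from_rel => r; case=> ->; apply: skl_ideal_rel; rewrite rel2 e1x e1y e1z.
  + exact: Or33.
  + exact: Or31.
  exact: Or32.
have scaled (i j k : 'I_3) : w ^+ (i + j) = w ^+ k * w ^+ k ->
    lin_subst (rV e2) (a *: (gen3 R i * gen3 R j) + b *: (gen3 R j * gen3 R i)
      + c *: gen3 R k ^+ 2) =
    w ^+ (i + j) *: (a *: (gen3 R i * gen3 R j) + b *: (gen3 R j * gen3 R i)
      + c *: gen3 R k ^+ 2).
  have act2 (i' j' : 'I_3) : lin_subst (rV e2) (gen3 R i' * gen3 R j') =
      w ^+ (i' + j') *: (gen3 R i' * gen3 R j').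
    rewrite exprD lin_substM; apply: etrans (malg_scaleM _ _ _ _).
    by congr (_ * _); exact: V1_gen2.
  move=> wk; apply: lin_subst_scaled.
  - exact: act2.
  - by rewrite addnC; exact: act2.
  by rewrite wk -exprD; exact: act2.
have idealZ k u : u \in skl_ideal a b c -> k *: u \in skl_ideal a b c.
  by move=> Iu; rewrite -[u]mul1r scalerAl; exact: skl_idealMl.
apply: from_rel => r rel_r; have Ir := skl_ideal_rel rel_r.
by case: rel_r Ir => -> Ir; rewrite scaled; try exact: idealZ;
  rewrite -exprD //= (exprS _ 3) w3 mulr1.
Qed.

End HeisenbergAction.

(** * Identification of the normal element *)

Section NormalElement.
Variable R : realType.
Local Notation C := R[i].
Variables a b c : C.
Hypothesis sm : smooth_curve (skl_curve a b c).
Local Notation pi := (skl_pi a b c).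
Local Notation inv al be ga := (al *: f1 R + be *: f2 R + ga *: f3 R).
Local Notation g0 := (inv (a * (b ^+ 3 - c ^+ 3)) (b * (c ^+ 3 - a ^+ 3))
  (c * (a ^+ 3 - b ^+ 3))).

Lemma opp2_invariant_neq0 : pi g0 <> 0.
Proof.
move=> pi0; have gI : g0 \in skl_ideal a b c.
  by rewrite -[g0]subr0; apply/skl_piE; rewrite pi0; exact: esym (raddf0 _).
(* Column 1 of a right inverse of the matrix with rows tau and -2 tau is a vector l with l.tau = 0
   and l.(-2 tau) = 1. The associated form vanishes on the ideal and takes the value 3 on [g0]. *)
have /row_freeP [B /matrixP BE] := row_free_tau_opp2 sm.
have tauB : \sum_k skl_tau a b c 0 k * B k 1 = 0.
  transitivity ((1%:M : 'M[C]_2) 0 1); last by rewrite mxE.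
  by rewrite -BE mxE; apply: eq_bigr => k _; rewrite col_mx20.
have oppB : \sum_k hesse_opp2 (skl_tau a b c) 0 k * B k 1 = 1.
  transitivity ((1%:M : 'M[C]_2) 1 1); last by rewrite mxE.
  by rewrite -BE mxE; apply: eq_bigr => k _; rewrite col_mx21.
pose l : 'rV[C]_3 := \row_k B k 1.
have sum3 (v : 'rV[C]_3) : \sum_k v 0 k * B k 1 =
    v 0 0 * l 0 0 + v 0 1 * l 0 1 + v 0 2 * l 0 2.
  rewrite !big_ord_recl big_ord0 addr0 addrA !mxE.
  by congr (_ + v 0 _ * B _ 1 + v 0 _ * B _ 1); apply: val_inj.
rewrite sum3 /hesse_opp2 !vec3E in oppB; rewrite sum3 !vec3E in tauB.
have := weight_form_ideal tauB gI; rewrite weight_form_invariant oppB.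
by move/eqP; rewrite Num.Theory.pnatr_eq0.
Qed.

Lemma c3_opp2 (s : sklyanin a b c) : is_c3 s ->
  exists2 k, k != 0 & s = k *: pi g0.
Proof.
case=> s0 [f f3E sE] _ s_ann; rewrite sE in s_ann.
have g0_ann : annihilates_points (pi g0).
  by move=> p _ M pM; exact: opp2_annihilates_point_module sm pM.
have [k pik] := skl_ideal_deg3 f3E (@homog3_invariant R _ _ _) ((s_ann _).2 g0_ann).
have k0 : k != 0.
  by apply/eqP => k0; apply: opp2_invariant_neq0; rewrite pik k0; exact: scale0r.
exists k^-1; first by rewrite invr_eq0.
apply: etrans sE (esym _).
exact: etrans (congr1 (fun t : sklyanin a b c => k^-1 *: t) pik) (scalerK k0 _).
Qed.

Definition line_map (s : sklyanin a b c) (k : C^o) : sklyanin a b c := k *: s.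

Lemma line_map_linear s : linear (line_map s).
Proof. by move=> k u v; rewrite /line_map scalerDl scalerA. Qed.

HB.instance Definition _ s := GRing.isLinear.Build C C^o (sklyanin a b c) *:%R
  (line_map s) (line_map_linear s).

End NormalElement.

Theorem proposition4p3 (R : realType) (a b c w : R[i])
    (gT : finGroupType) (H : {group gT}) (e1 e2 : gT)
    (rV : mx_representation R[i] H 3) (s : sklyanin a b c) :
    skl_tau a b c != 0 ->
    smooth_curve (skl_curve a b c) ->
    3.-primitive_root w ->
    is_H3 H e1 e2 ->
    is_V1 rV e1 e2 w ->
    is_c3 s ->
  [/\ trivial_line rV s,
      (forall f, h3_invariant rV 3 f <->
         exists al be ga : R[i], f = al *: f1 R + be *: f2 R + ga *: f3 R)
      /\ (forall al be ga : R[i], al *: f1 R + be *: f2 R + ga *: f3 R = 0 ->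
            [/\ al = 0, be = 0 & ga = 0]),
      exists al be ga : R[i],
        opp2_pt (skl_curve a b c) (skl_O R) (skl_tau a b c) (vec3 al be ga) &
      forall al be ga : R[i],
        opp2_pt (skl_curve a b c) (skl_O R) (skl_tau a b c) (vec3 al be ga) ->
        exists2 k : R[i], k != 0 &
          s = k *: skl_pi a b c (al *: f1 R + be *: f2 R + ga *: f3 R)].
Proof.
move=> tau0 sm w_prim H3 V1 c3s.
have gen1 := V1_gen1 V1; have gen2 := V1_gen2 V1.
have inv_fix al be ga g : g \in H -> lin_subst (rV g)
    (al *: f1 R + be *: f2 R + ga *: f3 R) = al *: f1 R + be *: f2 R + ga *: f3 R.
  apply: lin_subst_H3_fix H3 _ _ _ _ _.
    exact: invariant_fix1 gen1 _ _ _.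
  exact: invariant_fix2 w_prim gen2 _ _ _.
have [k k0 sE] := c3_opp2 sm c3s.
have hO := opp2_ptP sm _ tau0.
split.
- exists (line_map s); split.
  + move=> u v /eqP; rewrite -subr_eq0 -scalerBl scaler_eq0 => /orP[|].
      by rewrite subr_eq0 => /eqP.
    by case: c3s => /negbTE ->.
  + by move=> t; split=> -[l lE]; exists l; exact: esym lE.
  move=> g l Hg.
  have actE f : lin_subst (rV g) f = f ->
      skl_act (rV g) (skl_pi a b c f) = skl_pi a b c f.
    move=> f_fix; rewrite skl_actE ?f_fix // => u.
    exact: (lin_subst_H3_ideal H3 w_prim V1 Hg).
  (* An invariant representative in the free algebra turns the action on the quotient into
     [lin_subst]. *)
  have [f ff lE] : exists2 f, lin_subst (rV g) f = f & l *: s = skl_pi a b c f.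
    rewrite sE scalerA -skl_piZ; eexists; last by [].
    by rewrite lin_substZ; congr (_ *: _); exact: inv_fix.
  exact: etrans (congr1 (skl_act (rV g)) lE) (etrans (actE f ff) (esym lE)).
- split=> [f|al be ga inv0].
    split=> [[f3E f_fix]|[al [be [ga ->]]]].
      have [_ _ He1 He2] : [/\ True, True, e1 \in H & e2 \in H].
        by case: H3 => HE _ _ _; rewrite HE !mem_gen ?set21 ?set22.
      have [al [be [ga fE]]] :=
        fixed_invariant w_prim gen1 gen2 f3E (f_fix _ He1) (f_fix _ He2).
      by exists al, be, ga.
    by split; [exact: homog3_invariant | exact: inv_fix].
  (* The words xyz, xzy and xxx each occur in exactly one of f1, f2 and f3, so their coefficients
     are al, be and ga. *)
  have cf s' := mcoeff_invariant al be ga s'.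
  rewrite inv0 in cf; have := cf [:: 0; 1; 2]; have := cf [:: 0; 2; 1].
  have := cf [:: 0; 0; 0]; rewrite !mcoeff0 /word_weight /= !vec3E.
  by move=> <- <- <-.
- exists (a * (b ^+ 3 - c ^+ 3)), (b * (c ^+ 3 - a ^+ 3)), (c * (a ^+ 3 - b ^+ 3)).
  by apply/hO; exists 1; rewrite ?oner_eq0 // scale1r /hesse_opp2 !vec3E.
move=> al be ga /hO [r r0 /rowP e].
have := e 0; have := e 1; have := e 2; rewrite [hesse_opp2 _]lock !mxE -lock.
rewrite /= !vec3E => -> -> ->.
(* The chosen representative of -2 tau is r times the reference vector; dividing k by r
   compensates. *)
exists (k / r); first by rewrite mulf_neq0 ?invr_eq0.
have scale3 (V : lmodType R[i]) (u v t : V) p q n :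
    (r * p) *: u + (r * q) *: v + (r * n) *: t = r *: (p *: u + q *: v + n *: t).
  by rewrite !scalerDr !scalerA.
apply: etrans sE (esym _).
apply: etrans (congr1 (fun u => k / r *: skl_pi a b c u) (scale3 _ _ _ _ _ _ _)) _.
apply: etrans (congr1 (fun t : sklyanin a b c => k / r *: t) (skl_piZ _ _ _ _ _)) _.
by apply: etrans (scalerA _ _ _) _; rewrite divfK.
Qed.
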